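(* For every $z\in\mathbb{C}\setminus\mathcal{I}$, $$\mathsf{Q}(z)=\lim_{N\to\infty}|B_N(z)|^{-N^{-n}}.$$
   Context: Setting: $n\ge 1$, $\mathfrak{A}\subset\mathbb{Z}^n$ is a finite set, and $c_{\mathsf a}$ ($\mathsf a\in\mathfrak{A}$) are positive integers. $\Lambda\subset\mathbb{Z}^n$ is the lattice spanned over $\mathbb{Z}$ by all differences $\mathsf a-\mathsf b$ with $\mathsf a,\mathsf b\in\mathfrak{A}$; it is assumed throughout that $\Lambda$ has rank $n$. The dual lattice is $\Lambda^\vee=\{\mathsf t\in\mathbb{R}^n \mid \langle \mathsf t,\lambda\rangle\in\mathbb{Z}\ \forall\lambda\in\Lambda\}$. Let $\widehat{\mathcal D}(\mathsf t)=\sum_{\mathsf a\in\mathfrak{A}}c_{\mathsf a}e^{-2\pi i\langle \mathsf t,\mathsf a\rangle}$ for $\mathsf t\in\mathbb{R}^n$; the function $|\widehat{\mathcal D}(\mathsf t)|^2$ is $\Lambda^\vee$-periodic, so it descends to $\mathbb{R}^n/\Lambda^\vee$. For $N\in\mathbb{N}$, $r\in\mathbb{R}$ let $\mathrm{mult}_N(r)=\#\{\mathsf t\in\frac1N\Lambda^\vee/\Lambda^\vee \mid |\widehat{\mathcal D}(\mathsf t)|^2=r\}$ and $$B_N(z)=\prod_{r\in\mathbb{R}}(z-r)^{\mathrm{mult}_N(r)}.$$ Define $V:\mathbb{R}\to\mathbb{R}$ by $$V(r)=\frac{\mathrm{volume}\{\mathsf t\in\mathbb{R}^n/\Lambda^\vee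 \mid |\widehat{\mathcal D}(\mathsf t)|^2\le r\}}{\mathrm{volume}(\mathbb{R}^n/\Lambda^\vee)},$$ and let $dV(r)$ be the corresponding (Stieltjes) probability measure on $\mathbb{R}$, i.e. the push-forward under $|\widehat{\mathcal D}|^2$ of the normalized Lebesgue measure on $\mathbb{R}^n/\Lambda^\vee$. Let $\mathcal I=\overline{\{r\in\mathbb{R} \mid 0<V(r)<1\}}$ be its support, a subset of $[0,C^2]$ with $C=\sum_{\mathsf a}c_{\mathsf a}$. Finally, for $z\in\mathbb{C}\setminus\mathcal I$, $$\mathsf Q(z)=\exp\left(-\int_{\mathbb{R}}\log|z-r|\,dV(r)\right).$$ *)

(* Defs.v *)
From mathcomp Require Import all_boot all_order all_algebra finmap.
From mathcomp Require Import all_classical all_reals all_analysis.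
From mathcomp Require Export complex.

Set Implicit Arguments.
Unset Strict Implicit.
Unset Printing Implicit Defensive.

Import Order.TTheory GRing.Theory Num.Theory.
Import numFieldNormedType.Exports.

Local Open Scope classical_set_scope.
Local Open Scope complex_scope.
Local Open Scope ring_scope.

Section Lattices.
Context {n : nat}.
Implicit Types A : {fset 'rV[int]_n}.

(* The subgroup of Z^n spanned by the differences a - b, a, b \in A. *)
Definition difference_lattice A : set 'rV[int]_n :=
  [set l | exists m : 'rV[int]_n -> 'rV[int]_n -> int,
     l = \sum_(a <- A) \sum_(b <- A) m a b *: (a - b)].

Definition int_independent k (v : 'I_k -> 'rV[int]_n) : Prop :=
  forall m : 'I_k -> int,
    \sum_(i < k) m i *: v i = 0 -> forall i, m i = 0.

(* The rank of a subgroup L of Z^n is the maximal size of a Z-independent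
   family in L. *)
Definition has_rank (L : set 'rV[int]_n) (k : nat) : Prop :=
  (exists2 v : 'I_k -> 'rV[int]_n, (forall i, L (v i)) & int_independent v) /\
  (forall j (v : 'I_j -> 'rV[int]_n),
     (forall i, L (v i)) -> int_independent v -> (j <= k)%N).

Context {R : realType}.

Definition pairing (t : 'rV[R]_n) (a : 'rV[int]_n) : R :=
  \sum_(i < n) t 0 i * (a 0 i)%:~R.

Definition dual_lattice (L : set 'rV[int]_n) : set 'rV[R]_n :=
  [set t | forall l, L l -> pairing t l \in Num.int].

(* The class of t in R^n / L; subsets of R^n / L are sets of such classes. *)
Definition coset_mod (L : set 'rV[R]_n) (t : 'rV[R]_n) : set 'rV[R]_n :=
  [set s | L (s - t)].

End Lattices.

Section Volume.
Context {R : realType}.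

(* [measurableTypeR R] is R with the structure carrying [lebesgue_measure];
   tuples over it carry the product sigma-algebra. *)
Fixpoint lebesgue_tuple n : set (n.-tuple (measurableTypeR R)) -> \bar R :=
  match n return set (n.-tuple (measurableTypeR R)) -> \bar R with
  | 0%N => \d_[tuple]
  | m.+1 => fun X =>
      (@lebesgue_measure R \x @lebesgue_tuple m)%E
        [set p : measurableTypeR R * m.-tuple (measurableTypeR R) |
           X [tuple of p.1 :: p.2]]
  end.

Definition row_of_tuple n (t : n.-tuple (measurableTypeR R)) : 'rV[R]_n :=
  \row_i tnth t i.

Definition volume n (X : set 'rV[R]_n) : \bar R :=
  lebesgue_tuple (@row_of_tuple n @^-1` X).

Definition is_fundamental_domain n (L F : set 'rV[R]_n) : Prop :=
  measurable (@row_of_tuple n @^-1` F) /\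
  (forall t, exists! s, F s /\ coset_mod L t s).

(* For L a lattice of full rank, fundamental domains exist and [quotient_volume]
   does not depend on which one is chosen. *)
Definition fundamental_domain n (L : set 'rV[R]_n) : set 'rV[R]_n :=
  xget set0 [set F | is_fundamental_domain L F].

Definition quotient_volume n (L : set 'rV[R]_n) (S : set (set 'rV[R]_n)) :
    \bar R :=
  volume (fundamental_domain L `&` coset_mod L @^-1` S).

Definition normalized_volume n (L : set 'rV[R]_n) (S : set (set 'rV[R]_n)) :
    \bar R :=
  (quotient_volume L S * (fine (quotient_volume L (range (coset_mod L))))^-1%:E)%E.

End Volume.

Section Diffraction.
Context {R : realType} {n : nat}.
Variables (A : {fset 'rV[int]_n}) (c : 'rV[int]_n -> nat).

Definition cabs (z : R[i]) : R := ComplexField.Normc.normc z.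

Definition expi (theta : R) : R[i] := cos theta +i* sin theta.

Definition Dhat (t : 'rV[R]_n) : R[i] :=
  \sum_(a <- A) (c a)%:R * expi (- 2 * pi * pairing t a).

Definition intensity (t : 'rV[R]_n) : R := cabs (Dhat t) ^+ 2.

Definition period_lattice : set 'rV[R]_n :=
  dual_lattice (difference_lattice A).

Definition scaled_period_lattice (N : nat) : set 'rV[R]_n :=
  [set N%:R^-1 *: u | u in period_lattice].

(* The set of classes mod L of the vectors satisfying P; for the
   L-periodic conditions used below, it is the subset of R^n / L cut out by P. *)
Definition classes (P : set 'rV[R]_n) : set (set 'rV[R]_n) :=
  coset_mod period_lattice @` P.

Definition mult (N : nat) (r : R) : nat :=
  #|` fset_set (classes (scaled_period_lattice N `&` intensity @^-1` [set r]))|.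

(* Finitely supported: [mult N r] vanishes for all but finitely many r. *)
Definition B (N : nat) (z : R[i]) : R[i] :=
  \big[*%R/1]_(r \in [set: R]) (z - r%:C) ^+ mult N r.

Definition V (r : R) : R :=
  fine (normalized_volume period_lattice
          (classes [set t | intensity t <= r])).

Definition dV (X : set R) : \bar R :=
  normalized_volume period_lattice (classes (intensity @^-1` X)).

Definition spectrum : set R := closure [set r | 0 < V r < 1].

Definition Q (z : R[i]) : R :=
  expR (- fine (\int[dV]_(r in [set: R]) (ln (cabs (z - r%:C)))%:E)%E).

End Diffraction.

(* Main.v *)
(** Write L for the period lattice and phi for the intensity.  The Smith normal
    form of a generating matrix of the difference lattice gives an invertible E
    such that x is in L iff x E is an integral vector.  By translation
    invariance of Lebesgue measure, all measurable fundamental domains of L give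
    the same volume to an L-periodic set; hence dV is the image under phi of a
    probability nu which is translation invariant on L-periodic sets.  The
    intensity is not constant (it drops below phi(0) where two of its terms have
    opposite phases), so the spectrum contains its range, and
    g = ln |z - phi| is bounded, Lipschitz and L-periodic for z outside the
    spectrum.  Let S(t) be the mean of g over t + (1/N) L / L.  Integrating
    against nu, S has the same mean as g.  But S is (1/N) L-periodic, and every
    vector is within O(1/N) of (1/N) L, so S is within O(1/N) of S(0), which is
    N^-n ln |B_N(z)|. *)

From HB Require Import structures.
Require Import Defs.
From mathcomp Require Import all_boot all_order all_algebra finmap.
From mathcomp Require Import all_classical all_reals all_analysis.
From mathcomp Require Import measurable_realfun ring lra.

Set Implicit Arguments.
Unset Strict Implicit.
Unset Printing Implicit Defensive.

Import Order.TTheory GRing.Theory Num.Theory.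
Import numFieldNormedType.Exports.

Local Open Scope classical_set_scope.
Local Open Scope complex_scope.
Local Open Scope ring_scope.

(** * A Smith basis of the period lattice *)

Lemma det_col0 {R : comNzRingType} {n} (M : 'M[R]_n) j :
  (forall i, M i j = 0) -> \det M = 0.
Proof. by move=> M0; rewrite (expand_det_col _ j) big1// => i _;
  rewrite M0 mul0r. Qed.

(** A singular integral matrix has a nonzero integral vector in its left kernel, and such a vector
    is a relation between the rows. *)
Lemma int_independent_det n (v : 'I_n -> 'rV[int]_n) :
  int_independent v -> \det (\matrix_i v i) != 0.
Proof.
move=> indv; apply/det0P => -[x /eqP x0 xW]; apply: x0; apply/rowP => i.
rewrite mxE; apply: (indv (fun i => x 0 i)).
rewrite -[RHS]xW mulmx_sum_row.
by apply: eq_bigr => j _; rewrite rowK.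
Qed.

Lemma difference_lattice_generators n (A : {fset 'rV[int]_n}) :
  exists k (M : 'M[int]_(k, n)),
    (forall i, exists2 a, a \in A & exists2 b, b \in A & row i M = a - b) /\
    (forall l, difference_lattice A l -> exists x, l = x *m M).
Proof.
pose s := [seq a - b | a <- A, b <- A].
exists (size s), (\matrix_(i < size s) s`_i); split=> [i|l [m ->]].
  rewrite rowK; have /allpairsP[[a b] /= [aA bA ->]] := mem_nth 0 (ltn_ord i).
  by exists a => //; exists b.
rewrite big_seq; apply: (big_ind (fun l => exists x, l = x *m _)).
- by exists 0; rewrite mul0mx.
- by move=> _ _ [x ->] [y ->]; exists (x + y); rewrite mulmxDl.
move=> a aA; rewrite big_seq; apply: (big_ind (fun l => exists x, l = x *m _)).
- by exists 0; rewrite mul0mx.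
- by move=> _ _ [x ->] [y ->]; exists (x + y); rewrite mulmxDl.
move=> b bA; have abs : a - b \in s by apply/allpairsP; exists (a, b).
have lts : (index (a - b)%R s < size s)%N by rewrite index_mem.
(* [index] sends the coefficient of [a - b] to the first row equal to it, so repeated differences
   are harmless. *)
exists (m a b *: delta_mx 0 (Ordinal lts)).
by rewrite -scalemxAl -rowE rowK nth_index.
Qed.

(** In the Smith form M = L D U the factor L^T is invertible over the integers, so t M^T is integral
    iff t U^T D^T is. The factor D^T only multiplies the coordinates of t U^T by the diagonal
    entries, whence E = U^T diag(d). A nonsingular [W] factoring through [M] forces these entries to
    be nonzero. *)
Lemma int_dual_basis (R : realType) k n (M : 'M[int]_(k, n))
    (W : 'M[int]_n) X : \det W != 0 -> W = X *m M ->
  exists2 E : 'M[R]_n, E \in unitmx & forall t : 'rV[R]_n,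
    t *m map_mx intr M^T \is a mxOver Num.int <->
    t *m E \is a mxOver Num.int.
Proof.
move=> detW WE; have [L uL [U uU [d _ ME]]] := int_Smith_normal_form M.
set D := (\matrix_(_, _) _) in ME.
(* An index [j] past the last row of [D], or a zero diagonal entry, gives [D] a zero column, which
   would make [W] singular. *)
have dn0 (j : 'I_n) : (j < k)%N && (d`_j != 0).
  apply: contraNT detW; rewrite negb_and -leqNgt negbK => dj.
  have -> : \det W = \det (X *m L *m D) * \det U.
    by rewrite -det_mulmx WE ME !mulmxA.
  rewrite [X in X * _](_ : _ = 0) ?mul0r//; apply: (@det_col0 _ _ _ j) => i.
  rewrite mxE big1// => h _; rewrite [D _ _]mxE; case: eqP => [hj|_].
    by move: dj; rewrite leqNgt -hj ltn_ord/= => /eqP ->; rewrite mul0rn mulr0.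
  by rewrite mulr0n mulr0.
pose u := \row_(j < n) (d`_j)%:~R : 'rV[R]_n.
have uUR : map_mx intr U^T \in @unitmx R n.
  by rewrite unitmxE det_map_mx rmorph_unit// det_tr.
have LV : map_mx intr L^T *m map_mx intr (invmx L^T) = 1%:M :> 'M[R]_k.
  by rewrite -map_mxM/= mulmxV ?unitmx_tr// map_mx1.
exists (map_mx intr U^T *m diag_mx u).
  rewrite unitmx_mul uUR/= unitmxE det_diag unitfE.
  apply/prodf_neq0 => j _.
  by rewrite mxE intr_eq0; case/andP: (dn0 j).
have intM m p (Z : 'M[int]_(m, p)) :
    (map_mx intr Z : 'M[R]__) \is a mxOver Num.int.
  by apply/mxOverP => i j; rewrite mxE rpred_int.
move=> t; set y := t *m map_mx intr U^T.
have -> : t *m map_mx intr M^T = y *m map_mx intr D^T *m map_mx intr L^T.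
  by rewrite ME !trmx_mul !map_mxM/= !mulmxA.
have yD (i : 'I_k) (j : 'I_n) : i = j :> nat ->
    (y *m map_mx intr D^T) 0 i = (t *m (map_mx intr U^T *m diag_mx u)) 0 j.
  move=> ij; rewrite mulmxA mul_mx_diag !mxE (bigD1 j)//= big1 ?addr0.
    by rewrite !mxE ij eqxx mulr1n.
  move=> l lj; rewrite !mxE ij [_ == _ :> nat]eq_sym.
  by rewrite (negbTE (_ : l != j :> nat))// mulr0n mulr0z mulr0.
split=> [tM|tE].
  apply/mxOverP => i0 j; rewrite ord1.
  have ltjk : (j < k)%N by case/andP: (dn0 j).
  rewrite -(yD (Ordinal ltjk))//.
  have : y *m map_mx intr D^T \is a mxOver Num.int.
    by rewrite -[X in X \is a _]mulmx1 -LV mulmxA mxOverM.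
  by move/mxOverP; apply.
apply: mxOverM => //; apply/mxOverP => i0 i; rewrite ord1.
have [ltin|lein] := ltnP i n.
  by rewrite (yD _ (Ordinal ltin))//; move/mxOverP: tE; apply.
(* The rows of the rectangular [D] past the first [n] vanish, so this coordinate is 0. *)
rewrite mxE big1 ?rpred0// => j _; rewrite !mxE.
by rewrite gtn_eqF ?(leq_trans (ltn_ord j))// mulr0n mulr0z mulr0.
Qed.

Section pairing_theory.
Context {R : realType} {n : nat}.
Implicit Types (t u : 'rV[R]_n) (a b : 'rV[int]_n).

Lemma pairingDl t u a : pairing (t + u) a = pairing t a + pairing u a.
Proof. by rewrite -big_split; apply: eq_bigr => i _; rewrite mxE mulrDl. Qed.

Lemma pairingBr t a b : pairing t (a - b) = pairing t a - pairing t b.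
Proof.
rewrite -sumrB; apply: eq_bigr => i _.
by rewrite !mxE intrD intrN mulrBr.
Qed.

Lemma pairing_row t k (M : 'M[int]_(k, n)) i :
  pairing t (row i M) = (t *m map_mx intr M^T) 0 i.
Proof. by rewrite mxE; apply: eq_bigr => j _; rewrite !mxE. Qed.

(** The pairing is additive in its second argument, so integrality on the generators of the
    difference lattice suffices. *)
Lemma period_latticeE (A : {fset 'rV[int]_n}) t : period_lattice A t <->
  {in A &, forall a b, pairing t (a - b) \in Num.int}.
Proof.
split=> [tL a b aA bA|tA _ [m ->]].
  apply: tL; exists (fun x y => ((x == a) && (y == b))%:R).
  rewrite (big_fsetD1 a)//= (big_fsetD1 b)//= !eqxx scale1r.
  rewrite big1_fset ?addr0 => [|y /fsetD1P[yb _] _]; last first.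
    by rewrite (negbTE yb) andbF scale0r.
  rewrite big1_fset ?addr0// => x /fsetD1P[xa _] _.
  by rewrite big1// => y _; rewrite (negbTE xa) scale0r.
have pD : {morph pairing t : a b / a + b}.
  move=> a b; rewrite -[b in LHS]opprK pairingBr -[- b]add0r pairingBr.
  rewrite /pairing [X in _ - (X - _)]big1 => [|i _].
    by rewrite sub0r opprK.
  by rewrite mxE mulr0.
have p0 : pairing t 0 = 0 by rewrite /pairing big1// => i _; rewrite mxE mulr0.
have pZ k a : pairing t (k *: a) = k%:~R * pairing t a.
  by rewrite mulr_sumr; apply: eq_bigr => i _; rewrite mxE intrM mulrCA.
rewrite (big_morph _ pD p0) big_seq rpred_sum// => a aA.
rewrite (big_morph _ pD p0) big_seq rpred_sum// => b bA.
by rewrite pZ rpredM ?rpred_int ?tA.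
Qed.

End pairing_theory.

(** The coordinates [t *m E] identify the period lattice with Z^n. The independent vectors supplied
    by the rank hypothesis form the nonsingular matrix that [int_dual_basis] asks for. *)
Lemma period_lattice_basis (R : realType) n (A : {fset 'rV[int]_n}) :
  has_rank (difference_lattice A) n ->
  exists2 E : 'M[R]_n, E \in unitmx & forall t, period_lattice A t <->
    t *m E \is a mxOver Num.int.
Proof.
move=> [[v vA /int_independent_det detv] _].
have [k [M [rowM MA]]] := difference_lattice_generators A.
have /fin_all_exists[x xE] : forall i, exists x, v i = x *m M.
  by move=> i; exact: MA.
have [|E uE EP] := @int_dual_basis R k n M (\matrix_i v i) (\matrix_i x i) detv.
  by apply/row_matrixP => i; rewrite row_mul !rowK.
exists E => // t; rewrite -EP; split=> [tL|tM].
  apply/mxOverP => i0 i; rewrite ord1 -pairing_row.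
  have [a aA [b bA ->]] := rowM i.
  by move/period_latticeE : tL; apply.
move=> l /MA[z ->].
rewrite [pairing _ _](_ : _ = (t *m map_mx intr M^T *m map_mx intr z^T) 0 0).
  have: t *m map_mx intr M^T *m map_mx intr z^T \is a mxOver Num.int.
    by apply: mxOverM => //; apply/mxOverP => i j; rewrite mxE rpred_int.
  by move/mxOverP; apply.
rewrite -mulmxA -map_mxM/= -trmx_mul -pairing_row; congr pairing.
by apply/rowP => j; rewrite [RHS]mxE.
Qed.

(** * Lebesgue measure on tuples *)

Section tuple_cons_measure.
Local Open Scope ereal_scope.
Context {R : realType} {n : nat}.
Local Notation RR := (measurableTypeR R).
Variable mu : {sigma_finite_measure set (n.-tuple RR) -> \bar R}.

Let tcons (p : (RR * n.-tuple RR)%type) : n.+1.-tuple RR :=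
  [tuple of p.1 :: p.2].
Let tuncons (t : n.+1.-tuple RR) : (RR * n.-tuple RR)%type :=
  (thead t, [tuple of behead t]).

Let tcons_measurable : measurable_fun [set: (RR * n.-tuple RR)%type] tcons.
Proof. exact: (measurable_cons measurable_fst measurable_snd). Qed.

Let tuncons_measurable : measurable_fun [set: n.+1.-tuple RR] tuncons.
Proof.
by apply: measurable_fun_pair;
  [exact: measurable_tnth|exact: measurable_behead].
Qed.

Let tconsK : cancel tcons tuncons.
Proof. by case=> x t; rewrite /tuncons theadE; congr pair; apply/val_inj. Qed.

Let pm : {measure set (RR * n.-tuple RR)%type -> \bar R} :=
  (@lebesgue_measure R \x mu)%E.

(** The successor step of [lebesgue_tuple], set up as a push-forward so that it can carry the
    structure of a sigma-finite measure. *)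
Definition tuple_cons_measure := pushforward pm tcons.

Let tuple_cons_measure0 : tuple_cons_measure set0 = 0.
Proof. exact: measure0. Qed.

Let tuple_cons_measure_ge0 X : 0 <= tuple_cons_measure X.
Proof. exact: measure_ge0. Qed.

Let tuple_cons_measure_sigma_additive : semi_sigma_additive tuple_cons_measure.
Proof. exact: (@measure_semi_sigma_additive _ _ _ (pushforward pm tcons)). Qed.

HB.instance Definition _ := isMeasure.Build _ _ _ tuple_cons_measure
  tuple_cons_measure0 tuple_cons_measure_ge0 tuple_cons_measure_sigma_additive.

Let tuple_cons_measure_sigma_finite : sigma_finite setT tuple_cons_measure.
Proof.
have /sigma_finiteP[F [FT ndF Foo]] := sigma_finiteT (@lebesgue_measure R).
have /sigma_finiteP[G [GT ndG Goo]] := sigma_finiteT mu.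
(* Both exhausting sequences increase, so the products of terms of equal index already cover
   everything. *)
exists (fun k => tuncons @^-1` (F k `*` G k)).
  rewrite -preimage_bigcup [X in _ @^-1` X](_ : _ = setT) ?preimage_setT//.
  apply/seteqP; split=> // -[x t] _.
  have [k _ Fkx] : (\bigcup_k F k) x by rewrite -FT.
  have [l _ Glt] : (\bigcup_k G k) t by rewrite -GT.
  exists (maxn k l) => //; split => /=.
  - by move: x Fkx; exact/subsetPset/ndF/leq_maxl.
  - by move: t Glt; exact/subsetPset/ndG/leq_maxr.
move=> k; have [mFk Fkoo] := Foo k; have [mGk Gkoo] := Goo k; split.
  rewrite -[X in measurable X]setTI; apply: tuncons_measurable => //.
  exact: measurableX.
rewrite /tuple_cons_measure /pushforward -comp_preimage (_ : tuncons \o tcons =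
  id).
  by rewrite preimage_id/= product_measure1E// lte_mul_pinfty// ge0_fin_numE.
by apply/funext => p; exact: tconsK.
Qed.

HB.instance Definition _ := Measure_isSigmaFinite.Build _ _ _ tuple_cons_measure
  tuple_cons_measure_sigma_finite.

End tuple_cons_measure.

Section lebesgue_tuple.
Local Open Scope ereal_scope.
Context {R : realType}.
Local Notation RR := (measurableTypeR R).
Local Notation leb := (@lebesgue_measure R).

(** [lebesgue_tuple] is defined by recursion as a bare set function. The induction finds a bundled
    measure with the same values, from which the instances below take their axioms. *)
Lemma lebesgue_tuple_measure n :
  exists nu : {sigma_finite_measure set (n.-tuple RR) -> \bar R},
    nu = @lebesgue_tuple R n :> (set _ -> \bar R).
Proof.
elim: n => [|n [mu muE]].
  by exists (\d_[tuple] : {sigma_finite_measure set _ -> \bar R}).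
exists (tuple_cons_measure mu).
by rewrite /= -muE.
Qed.

Let lebesgue_tuple0 n : @lebesgue_tuple R n set0 = 0.
Proof. by have [nu <-] := lebesgue_tuple_measure n; exact: measure0. Qed.

Let lebesgue_tuple_ge0 n X : 0 <= @lebesgue_tuple R n X.
Proof. by have [nu <-] := lebesgue_tuple_measure n; exact: measure_ge0. Qed.

Let lebesgue_tuple_sigma_additive n : semi_sigma_additive (@lebesgue_tuple R n).
Proof.
by have [nu <-] := lebesgue_tuple_measure n; exact: measure_semi_sigma_additive.
Qed.

HB.instance Definition _ n := isMeasure.Build _ _ _ (@lebesgue_tuple R n)
  (@lebesgue_tuple0 n) (@lebesgue_tuple_ge0 n)
  (@lebesgue_tuple_sigma_additive n).

Let lebesgue_tuple_sigma_finite n : sigma_finite setT (@lebesgue_tuple R n).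
Proof. by have [nu <-] := lebesgue_tuple_measure n; exact: sigma_finiteT. Qed.

HB.instance Definition _ n := Measure_isSigmaFinite.Build _ _ _
  (@lebesgue_tuple R n) (@lebesgue_tuple_sigma_finite n).

(** By uniqueness of Lebesgue measure it is enough to compare half-open intervals. *)
Lemma lebesgue_measure_shift (y : R) (X : set RR) : measurable X ->
  leb [set x | X (x + y)%R] = leb X.
Proof.
move=> mX.
have mf : measurable_fun [set: RR] (fun x : RR => (x + y)%R : RR).
  exact: measurable_funD.
symmetry.
apply: (@lebesgue_measure_unique R (pushforward leb (fun x : RR => (x + y)%R :
  RR))) => //.
move=> _ [[a b]] _ <-.
transitivity (leb `](a - y)%R, (b - y)%R]%classic).
  by rewrite !lebesgue_measure_itv/= !lte_fin ltrD2r -!EFinB opprB addrA subrK.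
by congr (leb _); apply/seteqP; split=> x /=; rewrite !in_itv/= ltrBlDr lerBrDr.
Qed.

Definition tadd {n} (s t : n.-tuple RR) : n.-tuple RR :=
  [tuple (tnth s i + tnth t i)%R | i < n].

Lemma measurable_tadd n (u : n.-tuple RR) :
  measurable_fun setT (fun t => tadd t u).
Proof.
apply/measurable_fun_tnthP => i.
rewrite (_ : _ \o _ = (fun t => tnth t i + tnth u i)%R).
  by apply: measurable_funD => //; exact: measurable_tnth.
by apply/funext => t /=; rewrite tnth_mktuple.
Qed.

(** Induction on [n]: the image of the product measure under the shift agrees with the product
    measure on rectangles, hence everywhere by uniqueness. *)
Lemma lebesgue_tuple_shift n (u : n.-tuple RR) X : measurable X ->
  lebesgue_tuple [set t | X (tadd t u)] = lebesgue_tuple X.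
Proof.
elim: n u X => [|n IH] u X mX.
  by congr lebesgue_tuple; apply/seteqP; split=> t /=;
    rewrite (tuple0 t) (tuple0 (tadd _ _)).
case/tupleP: u => y u.
pose f (p : (RR * n.-tuple RR)%type) := ((p.1 + y)%R : RR, tadd p.2 u).
have mf : measurable_fun setT f.
  apply: measurable_fun_pair; first by apply: measurable_funD.
  apply: (@measurableT_comp _ _ _ _ _ _ (fun t => tadd t u) setT snd).
    exact: measurable_tadd.
  exact: measurable_snd.
have mc := measurable_cons (@measurable_fst _ _ RR (n.-tuple RR))
  measurable_snd.
have mX' : measurable
    [set p : (RR * n.-tuple RR)%type | X [tuple of p.1 :: p.2]].
  by rewrite -[X in measurable X]setTI; exact: mc.
rewrite /=.
rewrite [RHS](@product_measure_unique _ _ _ _ _ leb (@lebesgue_tuple R n)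
   (pushforward (leb \x @lebesgue_tuple R n) f))//; last first.
  move=> A B mA mB.
  transitivity ((leb \x @lebesgue_tuple R n)
      ([set x : RR | A (x + y)%R] `*` [set t | B (tadd t u)])).
    by congr (product_measure1 _ _ _); apply/seteqP; split.
  rewrite product_measure1E.
  - by congr mule; [exact: lebesgue_measure_shift|exact: IH].
  - by rewrite -[X in measurable X]setTI; apply: measurable_funD.
  - by rewrite -[X in measurable X]setTI; exact: measurable_tadd.
have taddE (x : RR) (t : n.-tuple RR) :
    tadd [tuple of x :: t] [tuple of y :: u] = [tuple of (x + y)%R :: tadd t u].
  apply: eq_from_tnth => i; rewrite tnth_mktuple.
  by case: (unliftP ord0 i) => [j ->|->]; rewrite ?tnthS ?tnth0 ?tnth_mktuple.
congr (product_measure1 _ _ _).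
by apply/seteqP; split=> -[x t] /=; rewrite taddE.
Qed.

Lemma measurable_box n (I : 'I_n -> set RR) : (forall i, measurable (I i)) ->
  measurable [set t : n.-tuple RR | forall i, I i (tnth t i)].
Proof.
move=> mI; rewrite (_ : [set _ | _] =
    \bigcap_(i in [set: 'I_n]) ((fun t : n.-tuple RR => tnth t i) @^-1` I i)).
  apply: fin_bigcap_measurable => // i _.
  by rewrite -[X in measurable X]setTI; exact: measurable_tnth.
by apply/seteqP; split=> t /=; [move=> It i _; exact: It|move=> It i;
  exact: It].
Qed.

Lemma lebesgue_tuple_box n (I : 'I_n -> set RR) :
  (forall i, measurable (I i)) ->
  lebesgue_tuple [set t : n.-tuple RR | forall i, I i (tnth t i)] =
  \prod_(i < n) leb (I i).
Proof.
elim: n I => [|n IH] I mI.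
  rewrite big_ord0 (_ : [set _ | _] = setT) /= ?diracT//.
  by apply/seteqP; split => // t _ [].
rewrite big_ord_recl -IH//=.
rewrite -[RHS](@product_measure1E _ _ _ _ _ leb (@lebesgue_tuple R n))//;
  last first.
  by apply: (@measurable_box n (fun i => I (lift ord0 i))).
congr (product_measure1 _ _ _).
apply/seteqP; split=> [[x t]/= H|[x t]/= [Hx Ht] i].
  by split; [have := H ord0; rewrite tnth0|move=> i; have := H (lift ord0 i);
    rewrite tnthS].
by case: (unliftP ord0 i) => [j ->|->]; rewrite ?tnthS ?tnth0.
Qed.

End lebesgue_tuple.

(** * Volume and fundamental domains *)

Section volume_theory.
Context {R : realType} {n : nat}.
Local Notation RR := (measurableTypeR R).
Local Notation row := (@row_of_tuple R n).
Implicit Types (X Y : set 'rV[R]_n) (v : 'rV[R]_n).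

(* ['rV[R]_n] carries no sigma-algebra of its own. *)
Definition rmeasurable X := measurable (row @^-1` X).

Definition tuple_of_row v : n.-tuple RR := [tuple v 0 i | i < n].

Lemma tuple_of_rowK : cancel tuple_of_row row.
Proof. by move=> v; apply/rowP => i; rewrite mxE tnth_mktuple. Qed.

Lemma row_tadd s t : row (tadd s t) = row s + row t.
Proof. by apply/rowP => i; rewrite !mxE tnth_mktuple. Qed.

Lemma rmeasurable_shift v X : rmeasurable X -> rmeasurable [set x | X (x + v)].
Proof.
move=> mX; rewrite /rmeasurable (_ : _ @^-1` _ =
  (fun t => tadd t (tuple_of_row v)) @^-1` (row @^-1` X)).
  by rewrite -[X in measurable X]setTI; exact: measurable_tadd.
by apply/seteqP; split=> t /=; rewrite row_tadd tuple_of_rowK.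
Qed.

Lemma volume_shift v X : rmeasurable X -> volume [set x | X (x + v)] = volume X.
Proof.
move=> mX; rewrite /volume -[RHS](lebesgue_tuple_shift (tuple_of_row v))//.
by congr lebesgue_tuple; apply/seteqP; split=> t /=;
  rewrite row_tadd tuple_of_rowK.
Qed.

Lemma volume_le X Y : rmeasurable X -> rmeasurable Y -> X `<=` Y ->
  (volume X <= volume Y)%E.
Proof.
move=> mX mY XY; apply: le_measure; rewrite ?inE//.
by move=> t; exact: XY.
Qed.

(* [pickle_inv] and not [unpickle]: no member of the family may be repeated. *)
Let seq_of (I : countType) (Y : I -> set 'rV[R]_n) (k : nat) : set 'rV[R]_n :=
  if pickle_inv k is Some i then Y i else set0.

Let seq_of_bigcup (I : countType) (Y : I -> set 'rV[R]_n) :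
  \bigcup_k (seq_of Y k) = \bigcup_i Y i.
Proof.
apply/seteqP; split=> x [].
  by move=> k _; rewrite /seq_of; case: pickle_inv => // i Yi; exists i.
by move=> i _ Yi; exists (choice.pickle i) => //; rewrite /seq_of pickleK_inv.
Qed.

Let seq_of_measurable (I : countType) (Y : I -> set 'rV[R]_n) :
  (forall i, rmeasurable (Y i)) -> forall k, rmeasurable (seq_of Y k).
Proof.
move=> mY k; rewrite /seq_of; case: pickle_inv => [i|]; first exact: mY.
by rewrite /rmeasurable preimage_set0.
Qed.

Lemma rmeasurable_bigcup (I : countType) (Y : I -> set 'rV[R]_n) :
  (forall i, rmeasurable (Y i)) -> rmeasurable (\bigcup_i Y i).
Proof.
move=> mY; rewrite -seq_of_bigcup /rmeasurable preimage_bigcup.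
by apply: bigcupT_measurable => k; exact: seq_of_measurable.
Qed.

(** Countable subadditivity for the [X i], countable additivity for the disjoint [Y i]. *)
Lemma volume_bigcup_le (I : countType) (X Y : I -> set 'rV[R]_n) :
  (forall i, rmeasurable (X i)) -> (forall i, rmeasurable (Y i)) ->
  (forall i j, Y i `&` Y j !=set0 -> i = j) ->
  (forall i, volume (X i) = volume (Y i)) ->
  (volume (\bigcup_i X i) <= volume (\bigcup_i Y i))%E.
Proof.
move=> mX mY tY XY; rewrite -(seq_of_bigcup X) -(seq_of_bigcup Y) /volume
  !preimage_bigcup.
rewrite [leRHS]measure_semi_bigcup; last 3 first.
- by move=> k; exact: seq_of_measurable.
- apply/trivIsetP => k l _ _ kl; apply/eqP; apply: contra_neqT kl => /set0P[t].
  rewrite /= /seq_of; have := @pickle_invK I k; have := @pickle_invK I l.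
  case: pickle_inv => [j /= <-|_ _ []//]; case: pickle_inv => [i /= <-|_ []//]
    [Yi Yj].
  by congr choice.pickle; apply: tY; exists (row t).
- apply: bigcupT_measurable => k; exact: seq_of_measurable.
apply: (@le_trans _ _ (\sum_(k <oo) lebesgue_tuple (row @^-1` seq_of X k))%E).
  apply: measure_sigma_subadditive => //.
  - by move=> k; exact: seq_of_measurable.
  - apply: bigcupT_measurable => k; exact: seq_of_measurable.
rewrite le_eqVlt; apply/orP; left; apply/eqP/eq_eseriesr => k _.
by rewrite /seq_of; case: pickle_inv => [i|//]; exact: XY.
Qed.

End volume_theory.

Section fundamental_domains.
Context {R : realType} {n : nat} (L : set 'rV[R]_n).
Context (I : countType) (g : I -> 'rV[R]_n).
Hypothesis g_inj : injective g.
Hypothesis gL : forall x, L x <-> exists i, x = g i.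
Hypothesis LB : forall x y, L x -> L y -> L (x - y).
Implicit Types F S : set 'rV[R]_n.

(** The type [T] is left free so that sets are covered as well, with [T] equal to [Prop]. *)
Definition lattice_periodic (T : Type) (f : 'rV[R]_n -> T) :=
  forall x l, L l -> f (x + l) = f x.

Let L0 : inhabited I -> L 0.
Proof.
by move=> [k]; rewrite -(subrr (g k)); apply: LB; apply/gL; exists k.
Qed.

Let LN x : L x -> L (- x).
Proof.
by move=> Lx; rewrite -sub0r; apply: LB => //; have /gL[i _] := Lx; exact: L0.
Qed.

Lemma fundamental_domain_uniq F x y : is_fundamental_domain L F ->
  F x -> F y -> L (x - y) -> x = y.
Proof.
move=> [_ /(_ y)[s [[Fs Ls] us]]] Fx Fy Lxy.
have L00 : L 0 by have /gL[i _] := Lxy; exact: L0.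
by rewrite -(us x)// -(us y)//; split=> //; rewrite /coset_mod/= subrr.
Qed.

Lemma fundamental_domain_rep F x : is_fundamental_domain L F ->
  exists2 l, L l & F (x + l).
Proof.
by move=> [_ /(_ x)[s [[Fs Ls] _]]]; exists (s - x); rewrite // addrC subrK.
Qed.

Lemma fundamental_domain_shift F v : is_fundamental_domain L F ->
  is_fundamental_domain L [set x | F (x - v)].
Proof.
move=> [mF FL]; split; first exact: rmeasurable_shift.
move=> t; have [s [[Fs Ls] us]] := FL (t - v).
exists (s + v); split.
  rewrite /= addrK; split => //; rewrite /coset_mod/=.
  by move: Ls; rewrite /coset_mod/= opprB addrA.
move=> s' [/= Fs' Ls']; rewrite (us (s' - v)) ?subrK//; split => //.
by rewrite /coset_mod/= opprB addrA subrK.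
Qed.

(* The pieces of F in the various translates F' - l are moved into F'. *)
Let compare_le F F' S : is_fundamental_domain L F ->
  is_fundamental_domain L F' -> rmeasurable S -> lattice_periodic S ->
  (volume (F `&` S) <= volume (F' `&` S))%E.
Proof.
move=> dF dF' mS pS.
have [mF _] := dF; have [mF' _] := dF'.
pose X i := F `&` S `&` [set x | F' (x + g i)].
pose Y i := [set x | X i (x - g i)].
have Lg i : L (g i) by apply/gL; exists i.
have mX i : rmeasurable (X i).
  by apply: measurableI; [exact: measurableI|exact: rmeasurable_shift].
have mY i : rmeasurable (Y i) by exact: rmeasurable_shift.
have XE : F `&` S = \bigcup_i X i.
  apply/seteqP; split=> [x [Fx Sx]|x [i _ [[]]]//].
  by have [l /gL[i ->] F'xl] := fundamental_domain_rep x dF'; exists i.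
have YF : \bigcup_i Y i `<=` F' `&` S.
  move=> x [i _ [[Fx Sx] /=]]; rewrite subrK => F'x; split => //.
  by rewrite -(pS x (- g i))//; exact: LN.
rewrite XE; apply: le_trans (volume_le _ _ YF).
- apply: volume_bigcup_le => // [i j [x [[[Fi _] _] [[Fj _] _]]]|i].
    (* Both [x - g i] and [x - g j] lie in [F] and are congruent modulo [L], so they coincide. *)
    apply/g_inj/(@addIr _ (- x))/oppr_inj; rewrite !opprB -/(x - g i).
    apply: (fundamental_domain_uniq dF) => //.
    by rewrite opprD opprK addrACA subrr add0r addrC; apply: LB.
  - by rewrite /Y volume_shift.
- exact: rmeasurable_bigcup.
- by apply: measurableI.
Qed.

(** The preceding comparison applies in both directions. Volumes of periodic sets thus do not depend
    on the domain that [xget] selects. *)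
Lemma volume_fundamental_domain F F' S : is_fundamental_domain L F ->
  is_fundamental_domain L F' -> rmeasurable S -> lattice_periodic S ->
  volume (F `&` S) = volume (F' `&` S).
Proof. by move=> dF dF' mS pS; apply/eqP; rewrite eq_le !compare_le. Qed.

End fundamental_domains.

(** * Lattices of full rank *)

Section full_rank_lattice.
Context {R : realType} {n : nat} (E : 'M[R]_n) (L : set 'rV[R]_n).
Hypothesis uE : E \in unitmx.
Hypothesis LE : forall x, L x <-> x *m E \is a mxOver Num.int.
Local Notation RR := (measurableTypeR R).
Local Notation row := (@row_of_tuple R n).

Definition lattice_point (m : 'rV[int]_n) : 'rV[R]_n :=
  map_mx intr m *m invmx E.

Lemma lattice_point_inj : injective lattice_point.
Proof.
move=> m m' /(congr1 (mulmx^~ E)); rewrite !mulmxKV// => /rowP mm'.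
by apply/rowP => j; have := mm' j; rewrite !mxE => /intr_inj.
Qed.

Lemma lattice_pointP x : L x <-> exists m, x = lattice_point m.
Proof.
rewrite LE; split=> [/mxOverP xE|[m ->]]; last first.
  by apply/mxOverP => i j; rewrite mulmxKV// mxE rpred_int.
exists (\row_j Num.floor ((x *m E) 0 j)); rewrite -[LHS](mulmxK uE);
  congr mulmx.
by apply/rowP => j; rewrite [RHS]mxE [X in X%:~R]mxE floorK ?xE.
Qed.

Lemma lattice_subr x y : L x -> L y -> L (x - y).
Proof.
rewrite !LE => /mxOverP xL /mxOverP yL; apply/mxOverP => i j.
by rewrite mulmxBl [X in X \in _]mxE [X in _ + X]mxE rpredB.
Qed.

Lemma lattice_point_in m : L (lattice_point m).
Proof. by apply/lattice_pointP; exists m. Qed.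

Definition parallelepiped : set 'rV[R]_n :=
  [set x | forall j, 0 <= (x *m E) 0 j < 1].

Lemma measurable_mulmx (M : 'M[R]_n) j :
  measurable_fun setT (fun t : n.-tuple RR => (row t *m M) 0 j).
Proof.
rewrite (_ : (fun _ => _) = (fun t : n.-tuple RR => \sum_(i < n) tnth t i * M i
  j)).
  apply: measurable_sum => i; apply: measurable_funM => //.
  exact: measurable_tnth.
by apply/funext => t; rewrite mxE; apply: eq_bigr => i _; rewrite mxE.
Qed.

(** The representative of a class is found by taking fractional parts of the coordinates
    [t *m E]. *)
Lemma parallelepiped_fundamental : is_fundamental_domain L parallelepiped.
Proof.
split.
  rewrite (_ : _ @^-1` _ = \bigcap_(j in [set: 'I_n])
      ((fun t : n.-tuple RR => (row t *m E) 0 j) @^-1` `[0, 1[%classic)).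
    apply: fin_bigcap_measurable => // j _.
    rewrite -[X in measurable X]setTI.
    by apply: measurable_mulmx.
  apply/seteqP; split=> t /= Pt j; first by move=> _; rewrite /= in_itv/=;
    exact: Pt.
  by have := Pt j Logic.I; rewrite /= in_itv.
move=> t; pose m := \row_j Num.floor ((t *m E) 0 j).
have mE j : ((t - lattice_point m) *m E) 0 j =
    (t *m E) 0 j - (Num.floor ((t *m E) 0 j))%:~R.
  by rewrite mulmxBl mulmxKV// mxE [X in _ + X]mxE [X in - X]mxE [X in
    X%:~R]mxE.
exists (t - lattice_point m); split.
  split.
    by move=> j; rewrite mE subr_ge0 floor_le/= ltrBlDl -(intrD _ _ 1)
      floorD1_gt.
  rewrite /coset_mod/= addrC addKr (_ : - _ = lattice_point (- m)).
    exact: lattice_point_in.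
  by rewrite /lattice_point -mulNmx; congr mulmx; apply/matrixP => i j;
    rewrite !mxE mulrNz.
move=> s [Ps /LE/mxOverP Ls]; apply/(can_inj (mulmxK uE))/rowP => j.
have := Ls 0 j; rewrite mulmxBl mxE [X in _ + X]mxE.
set d := _ - _ => dint; rewrite mE.
have sE : (s *m E) 0 j = (t *m E) 0 j + d by rewrite /d addrC subrK.
(* The coordinate of [s] has floor 0 and differs from that of [t] by the integer [d], so [d] is
   minus the floor of the latter. *)
have := floorDrz ((t *m E) 0 j) dint; rewrite -sE (@floor_def _ _ 0) ?Ps//.
move=> /eqP; rewrite eq_sym addrC addr_eq0 => /eqP /(congr1 (intr : int -> R)).
by rewrite floorK// mulrNz => dE; rewrite sE dE.
Qed.

Lemma parallelepiped_bounded : exists2 K : R, 0 < K &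
  forall x, parallelepiped x -> forall j, `|x 0 j| <= K.
Proof.
(* A point is its coordinate vector, with entries in [0, 1), times the inverse of [E]; the summand 1
   makes the bound positive. *)
exists (1 + \sum_i \sum_j `|invmx E i j|).
  by rewrite ltr_pwDl// sumr_ge0// => i _; apply: sumr_ge0.
move=> x Px j; rewrite -[x](mulmxK uE) mxE.
apply: le_trans (ler_norm_sum _ _ _) _.
rewrite -[leLHS]add0r lerD//; apply: ler_sum => i _; rewrite normrM.
have /andP[x0 x1] := Px i; rewrite (bigD1 j)//= -[leLHS]addr0 lerD//;
  last first.
  exact: sumr_ge0.
by rewrite ler_piMl// ger0_norm// ltW.
Qed.

Definition cube (x0 : 'rV[R]_n) (e : R) : set 'rV[R]_n :=
  [set x | forall i, `|x 0 i - x0 0 i| < e].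

Lemma cube_box x0 e : row @^-1` cube x0 e =
  [set t | forall i, `]x0 0 i - e, x0 0 i + e[%classic (tnth t i)].
Proof.
apply/seteqP; split=> t /= H i; have := H i;
  by rewrite /= !mxE in_itv/= ltr_distl.
Qed.

Lemma rmeasurable_cube x0 e : rmeasurable (cube x0 e).
Proof.
rewrite /rmeasurable cube_box.
exact: (@measurable_box R n (fun i => `]x0 0 i - e, x0 0 i + e[%classic)).
Qed.

Lemma volume_cube x0 e : 0 < e -> (0 < volume (cube x0 e) < +oo)%E.
Proof.
move=> e0; rewrite /volume cube_box
  (@lebesgue_tuple_box R n (fun i => `]x0 0 i - e, x0 0 i + e[%classic))//.
have I (i : 'I_n) :
    lebesgue_measure (`]x0 0 i - e, x0 0 i + e[%classic) = (e + e)%:E.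
  rewrite lebesgue_measure_itv/= lte_fin ltrBlDr -addrA ltrDl addr_gt0//.
  by rewrite -EFinD; congr EFin; ring.
under eq_bigr do rewrite I.
apply/andP; split.
  by apply: (big_ind (fun x => 0 < x)%E) => //[*|*]; [exact: mule_gt0|rewrite
    lte_fin addr_gt0].
by rewrite ltey_eq; apply/orP; left; apply: (big_ind (fun x => x \is a fin_num))
  => // *; exact: fin_numM.
Qed.

Variables (F : set 'rV[R]_n).
Hypothesis dF : is_fundamental_domain L F.

(** [F] has the volume of the parallelepiped, which lies in a cube. *)
Lemma volume_fundamental_lty : (volume F < +oo)%E.
Proof.
have mT : rmeasurable (@setT 'rV[R]_n) by rewrite /rmeasurable preimage_setT.
rewrite -[F]setIT (@volume_fundamental_domain _ _ L _ _ lattice_point_inj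
  lattice_pointP lattice_subr _ parallelepiped)//;
    last exact: parallelepiped_fundamental.
have [K K0 PK] := parallelepiped_bounded.
have K1 : 0 < K + 1 by rewrite addr_gt0.
have /andP[_] := volume_cube 0 K1; apply: le_lt_trans.
apply: volume_le.
- rewrite setIT; by have [] := parallelepiped_fundamental.
- exact: rmeasurable_cube.
- move=> x [Px _] i; rewrite mxE subr0.
  by apply: le_lt_trans (PK x Px i) _; rewrite ltrDl.
Qed.

(** If [F] met [S] in a null set, countably many translates of this null set would cover [S] and
    hence the cube, which has positive volume. *)
Lemma volume_periodic_gt0 (S : set 'rV[R]_n) x0 e : rmeasurable S ->
  lattice_periodic L S -> 0 < e -> cube x0 e `<=` S -> (0 < volume (F `&` S))%E.
Proof.
move=> mS pS e0 eS; have [mF _] := dF.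
have mFS : rmeasurable (F `&` S) by exact: measurableI.
rewrite lt0e measure_ge0 andbT; apply/eqP => FS0.
pose X m := [set x | (F `&` S) (x + lattice_point m)].
have SX : S `<=` \bigcup_m X m.
  move=> x Sx; have [l Ll Fxl] := fundamental_domain_rep x dF.
  have /lattice_pointP[m lm] := Ll; exists m => //.
  by rewrite /X/= -lm; split => //; rewrite pS.
have mX m : rmeasurable (X m) by exact: rmeasurable_shift.
(* Comparing with a family of empty sets shows that a countable union of null sets is null. *)
have : (volume (\bigcup_m X m) <= 0)%E.
  have <- : volume (\bigcup_(m : 'rV[int]_n) set0 : set 'rV[R]_n) = 0.
    by rewrite bigcup0// /volume preimage_set0 measure0.
  apply: volume_bigcup_le => //.
  - by move=> m; rewrite /rmeasurable preimage_set0.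
  - by move=> i j [x []].
  - by move=> m; rewrite volume_shift// /volume preimage_set0 measure0.
apply/negP; rewrite -ltNge.
have /andP[+ _] := volume_cube x0 e0; move=> /lt_le_trans; apply.
apply: volume_le; [exact: rmeasurable_cube|exact: rmeasurable_bigcup|].
exact: subset_trans SX.
Qed.

Lemma volume_fundamental_gt0 : (0 < volume F)%E.
Proof.
rewrite -[F]setIT; apply: (@volume_periodic_gt0 _ 0 1) => //.
by rewrite /rmeasurable preimage_setT.
Qed.

End full_rank_lattice.

(** * The intensity *)

Section cabs_theory.
Context {R : realType}.
Implicit Types z w : R[i].

Lemma cabsM : {morph @cabs R : z w / z * w}.
Proof. exact: Normc.normcM. Qed.

Lemma cabsD z w : cabs (z + w) <= cabs z + cabs w.
Proof. exact: complex.le_normcD. Qed.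

Lemma cabsN z : cabs (- z) = cabs z.
Proof. by case: z => a b; rewrite /cabs /= !sqrrN. Qed.

Lemma cabs_ge0 z : 0 <= cabs z.
Proof. by case: z => a b; exact: sqrtr_ge0. Qed.

Lemma cabs0 : cabs 0 = 0 :> R.
Proof. exact: Normc.normc0. Qed.

Lemma cabs1 : cabs 1 = 1 :> R.
Proof. exact: Normc.normc1. Qed.

Lemma cabs_real (r : R) : cabs r%:C = `|r|.
Proof. by rewrite /cabs/= expr0n/= addr0 sqrtr_sqr. Qed.

Lemma cabs_nat k : cabs (k%:R : R[i]) = k%:R.
Proof. by rewrite -(rmorph_nat (real_complex R)) cabs_real normr_nat. Qed.

Lemma cabs_sum (I : Type) (s : seq I) (P : pred I) (f : I -> R[i]) :
  cabs (\sum_(i <- s | P i) f i) <= \sum_(i <- s | P i) cabs (f i).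
Proof.
elim/big_ind2: _ => [|z x w y zx wy|//]; first by rewrite cabs0.
exact: le_trans (cabsD _ _) (lerD zx wy).
Qed.

Lemma cabs_le z : cabs z <= `|complex.Re z| + `|complex.Im z|.
Proof.
case: z => a b /=; rewrite -[leRHS]ger0_norm ?addr_ge0// -sqrtr_sqr.
by rewrite ler_sqrt ?sqr_ge0// sqrrD !real_normK ?num_real// addrAC ler_wpDr.
Qed.

Lemma Im_le_cabs z : `|complex.Im z| <= cabs z.
Proof.
case: z => a b /=.
by rewrite -sqrtr_sqr ler_sqrt ?addr_ge0 ?sqr_ge0// lerDr sqr_ge0.
Qed.

Lemma Re_le_cabs z : `|complex.Re z| <= cabs z.
Proof.
case: z => a b /=.
by rewrite -sqrtr_sqr ler_sqrt ?addr_ge0 ?sqr_ge0// lerDl sqr_ge0.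
Qed.

Lemma cabs_dist z w : `|cabs z - cabs w| <= cabs (z - w).
Proof.
rewrite ler_norml lerBlDr lerNl opprB lerBlDr; apply/andP; split.
  by rewrite -(cabsN (z - w)) opprB; have := cabsD (w - z) z; rewrite subrK.
by have := cabsD (z - w) w; rewrite subrK.
Qed.

Lemma expiD (x y : R) : expi (x + y) = expi x * expi y.
Proof.
rewrite /expi cosD sinD; apply/eqP; rewrite eq_complex/= eqxx/=.
by rewrite addrC (mulrC (sin x)).
Qed.

Lemma expi0 : expi 0 = 1 :> R[i].
Proof. by rewrite /expi cos0 sin0. Qed.

Lemma cabs_expi (x : R) : cabs (expi x) = 1.
Proof. by rewrite /cabs/= cos2Dsin2 sqrtr1. Qed.

Lemma expi_int (x : R) : x \is a Num.int -> expi (- 2 * pi * x) = 1.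
Proof.
have expi_nat k : expi (- 2 * pi * k%:R : R) = 1.
  elim: k => [|k IH]; first by rewrite mulr0 expi0.
  rewrite -[k.+1]addn1 natrD mulrDr expiD IH mul1r mulr1 mulNr mulr_natl.
  by rewrite /expi cosN sinN cos2pi sin2pi oppr0.
move=> /intrP[[k|k] ->]; first exact: expi_nat.
have := expi_nat k.+1; rewrite NegzE mulrNz mulrN => e1.
by rewrite -[LHS]mulr1 -[in LHS]e1 -expiD addNr expi0.
Qed.

Lemma expi_half_int : expi (- 2 * pi * 2^-1) = -1 :> R[i].
Proof.
rewrite (_ : - 2 * pi / 2 = - pi); last by field.
rewrite /expi cosN sinN cospi sinpi oppr0.
by apply/eqP; rewrite eq_complex/= oppr0 !eqxx.
Qed.

Lemma derive_lipschitz (f df : R -> R) :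
  (forall x : R, is_derive x 1 f (df x)) -> continuous f ->
  (forall x, `|df x| <= 1) -> forall x y, `|f x - f y| <= `|x - y|.
Proof.
move=> fdf fc df1.
suff le x y : x <= y -> `|f y - f x| <= `|y - x|.
  move=> x y; have [xy|/ltW yx] := leP x y; last exact: le.
  by rewrite distrC (distrC x); exact: le.
move=> xy; have [c _ ->] := @MVT_segment R f df x y xy (fun u _ => fdf u)
  (continuous_subspaceT fc).
by rewrite normrM ler_piMl.
Qed.

(** The modulus is at most the sum of the absolute values of the real and imaginary parts, cosine
    and sine being 1-Lipschitz. *)
Lemma expi_lipschitz (x y : R) : cabs (expi x - expi y) <= 2 * `|x - y|.
Proof.
apply: le_trans (cabs_le _) _; rewrite mulr_natl mulr2n /=; apply: lerD.
  apply: (@derive_lipschitz _ (fun x => - sin x)); last by move=> *;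
    rewrite normrN sin_max.
  exact: continuous_cos.
apply: (@derive_lipschitz _ cos); last exact: cos_max.
exact: continuous_sin.
Qed.

End cabs_theory.

(** * Periodicity, Lipschitz bound, non-constancy and measurability of the intensity *)

Section intensity_theory.
Context {R : realType} {n : nat} (A : {fset 'rV[int]_n})
  (c : 'rV[int]_n -> nat).
Implicit Types (t s l : 'rV[R]_n).
Local Notation RR := (measurableTypeR R).
Local Notation phi := (@intensity R n A c).
Local Notation C := (\sum_(a <- A) (c a)%:R : R).

(** A shift by [l] multiplies the term of [a] by the phase of [pairing l a]. These pairings differ
    by integers, so the phase is common to all terms and does not change the modulus. *)
Lemma intensity_periodic : lattice_periodic (@period_lattice R n A) phi.
Proof.
move=> t l Ll; congr (_ ^+ 2).
have [w w1 Dw] : exists2 w : R[i], cabs w = 1 &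
    Dhat A c (t + l) = w * Dhat A c t.
  have [A0|/fset0Pn[a0 a0A]] := eqVneq A fset0.
    by exists 1; rewrite ?cabs1// /Dhat A0 !big_nil mulr0.
  exists (expi (- 2 * pi * pairing l a0)); first exact: cabs_expi.
  rewrite /Dhat mulr_sumr big_seq [RHS]big_seq; apply: eq_bigr => a aA.
  have lint : pairing l (a - a0) \is a Num.int by move/period_latticeE: Ll;
    apply.
  rewrite pairingDl mulrDr expiD.
  have -> : expi (- 2 * pi * pairing l a) = expi (- 2 * pi * pairing l a0).
    by rewrite -[RHS]mulr1 -(expi_int lint) pairingBr -expiD -mulrDr addrC
      subrK.
  by rewrite mulrA mulrC.
by rewrite Dw cabsM w1 mul1r.
Qed.

Lemma cabs_Dhat_le t : cabs (Dhat A c t) <= C.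
Proof.
apply: le_trans (cabs_sum _ _ _) _; apply: ler_sum => a _.
by rewrite cabsM cabs_nat cabs_expi mulr1.
Qed.

Lemma pairingBl t s a : pairing (t - s) a = pairing t a - pairing s a.
Proof. by apply/eqP; rewrite eq_sym subr_eq -pairingDl subrK. Qed.

Lemma pairing_le t a e : 0 <= e -> (forall i, `|t 0 i| <= e) ->
  `|pairing t a| <= e * \sum_(i < n) `|(a 0 i)%:~R|.
Proof.
move=> e0 te; apply: le_trans (ler_norm_sum _ _ _) _; rewrite mulr_sumr.
by apply: ler_sum => i _; rewrite normrM ler_wpM2r.
Qed.

Lemma intensity_lipschitz : exists2 K : R, 0 < K & forall t s (e : R), 0 <= e ->
  (forall i, `|t 0 i - s 0 i| <= e) -> `|phi t - phi s| <= K * e.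
Proof.
pose K := \sum_(a <- A) (c a)%:R * (2 * (2 * pi * \sum_(i < n) `|(a 0 i)%:~R|))
  : R.
have C0 : 0 <= C by apply: sumr_ge0.
have K0 : 0 <= K.
  apply: sumr_ge0 => a _; do ![apply: mulr_ge0 => //]; first exact: pi_ge0.
  exact: sumr_ge0.
(* [K] is a Lipschitz constant of the modulus of [Dhat], and [2 * C] bounds the sum of two such
   moduli in the difference of squares. The added 1 ensures positivity. *)
exists (2 * C * K + 1); first by rewrite ltr_wpDl// !mulr_ge0.
move=> t s e e0 ts; rewrite mulrDl mul1r ler_wpDr//.
have DK : `|cabs (Dhat A c t) - cabs (Dhat A c s)| <= K * e.
  apply: le_trans (cabs_dist _ _) _; rewrite -sumrB.
  apply: le_trans (cabs_sum _ _ _) _; rewrite mulr_suml; apply: ler_sum => a _.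
  rewrite -mulrBr cabsM cabs_nat -[leRHS]mulrA ler_wpM2l//.
  apply: le_trans (expi_lipschitz _ _) _; rewrite -[leRHS]mulrA ler_wpM2l//.
  have -> : `|- 2 * pi * pairing t a - - 2 * pi * pairing s a| =
      2 * pi * `|pairing (t - s) a|.
    rewrite -mulrBr -pairingBl normrM; congr (_ * _).
    by rewrite mulNr normrN; apply/ger0_norm/mulr_ge0 => //; exact: pi_ge0.
  rewrite -!mulrA ler_wpM2l// ler_wpM2l ?pi_ge0// mulrC.
  by apply: pairing_le => // i; rewrite !mxE.
rewrite /intensity subr_sqr normrM (_ : 2 * C * K * e = K * e * (2 * C));
  last by ring.
apply: ler_pM => //; rewrite mulr_natl mulr2n ger0_norm ?addr_ge0 ?cabs_ge0//.
by rewrite lerD// cabs_Dhat_le.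
Qed.

(** At 0 all terms have phase 1 and the modulus is [C]. If [pairing t (a - b)] is 1/2, the terms of
    [a] and [b] have opposite phases, and their sum has modulus |c_b - c_a| < c_a + c_b. *)
Lemma intensity_nonconstant : (0 < n)%N -> {in A, forall a, (0 < c a)%N} ->
  has_rank (difference_lattice A) n -> exists t s, phi t != phi s.
Proof.
move=> n0 c0 [[v vA indv] _].
have [a aA [b bA ab]] : exists2 a, a \in A & exists2 b, b \in A & a != b.
  (* If all elements of [A] were equal, every [v i] would be 0; since [n > 0], the relation with all
     coefficients 1 would then contradict independence. *)
  apply: contrapT => nab.
  have A1 a b : a \in A -> b \in A -> a - b = 0.
    move=> aA bA; apply/eqP; rewrite subr_eq0; apply/negPn/negP => ab.
    by apply: nab; exists a => //; exists b.
  have v0 i : v i = 0.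
    have [m ->] := vA i; rewrite big_seq big1// => a aA.
    by rewrite big_seq big1// => b bA; rewrite A1// scaler0.
  have s0 : \sum_(i < n) (1 : int) *: v i = 0 by rewrite big1// => i _;
    rewrite v0 scaler0.
  by have := indv (fun=> 1) s0 (Ordinal n0).
have [i abi] : exists i, (a - b) 0 i != 0.
  by apply/rV0Pn; rewrite subr_eq0.
(* Supported on one coordinate where [a] and [b] differ, and scaled so that the pairing with [a - b]
   is 1/2. *)
pose t := \row_j (if j == i then (2 * ((a - b) 0 i)%:~R)^-1 else 0) : 'rV[R]_n.
have abiR : ((a - b) 0 i)%:~R != 0 :> R by rewrite intr_eq0.
have tab : pairing t (a - b) = 2^-1.
  rewrite /pairing (bigD1 i)//= mxE eqxx big1 ?addr0; last first.
    by move=> j ji; rewrite mxE (negbTE ji) mul0r.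
  by rewrite invfM mulfVK.
exists t, 0; rewrite lt_eqF//.
have D0 : Dhat A c (0 : 'rV[R]_n) = C%:C.
  rewrite rmorph_sum; apply: eq_bigr => x _ /=.
  rewrite /pairing big1 => [|j _]; last by rewrite mxE mul0r.
  by rewrite mulr0 expi0 mulr1 rmorph_nat.
have C0 : 0 <= C by apply: sumr_ge0.
rewrite /intensity D0 cabs_real (ger0_norm C0) ltr_pXn2r// ?nnegrE ?cabs_ge0//.
rewrite /Dhat (big_fsetD1 a)//= (big_fsetD1 b)/=; last by rewrite !inE eq_sym
  ab.
rewrite [ltRHS](big_fsetD1 a)//= [X in _ < _ + X](big_fsetD1 b)/=;
  last by rewrite !inE eq_sym ab.
rewrite !addrA; apply: le_lt_trans (cabsD _ _) _; apply: ltr_leD; last first.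
  apply: le_trans (cabs_sum _ _ _) _; apply: ler_sum => x _.
  by rewrite cabsM cabs_nat cabs_expi mulr1.
have -> : expi (- 2 * pi * pairing t a) = - expi (- 2 * pi * pairing t b) :>
  R[i].
  have -> : pairing t a = pairing t b + 2^-1 by rewrite -tab pairingBr addrC
    subrK.
  by rewrite mulrDr expiD expi_half_int mulrN1.
rewrite mulrN addrC -mulrBl cabsM cabs_expi mulr1.
have -> : (c b)%:R - (c a)%:R = ((c b)%:R - (c a)%:R)%:C :> R[i].
  by rewrite rmorphB !rmorph_nat.
rewrite cabs_real ltr_norml; have := c0 _ aA; have := c0 _ bA.
rewrite -!(ltr_nat R); lra.
Qed.

Lemma intensityE t : phi t =
  (\sum_(a <- A) (c a)%:R * cos (- 2 * pi * pairing t a)) ^+ 2 +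
  (\sum_(a <- A) (c a)%:R * sin (- 2 * pi * pairing t a)) ^+ 2.
Proof.
rewrite /intensity.
have -> : Dhat A c t =
    (\sum_(a <- A) (c a)%:R * cos (- 2 * pi * pairing t a)) +i*
    (\sum_(a <- A) (c a)%:R * sin (- 2 * pi * pairing t a)).
  rewrite /Dhat; elim/big_rec3: _ => [//|a x y z _ ->].
  rewrite -(rmorph_nat (real_complex R)); apply/eqP; rewrite eq_complex/=.
  by rewrite !mul0r subr0 addr0 !eqxx.
by rewrite /cabs/= sqr_sqrtr// addr_ge0 ?sqr_ge0.
Qed.

Lemma measurable_intensity :
  measurable_fun setT (fun t : n.-tuple RR => phi (row_of_tuple t)).
Proof.
have mp a : measurable_fun setT (fun t : n.-tuple RR =>
    - 2 * pi * pairing (row_of_tuple t) a : R).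
  apply: measurable_funM => //; apply: measurable_sum => i.
  apply: measurable_funM => //; rewrite (_ : (fun _ => _) = (fun t : n.-tuple RR
    => tnth t i)).
    exact: measurable_tnth.
  by apply/funext => x; rewrite mxE.
under eq_fun do rewrite intensityE.
apply: measurable_funD; apply: measurable_funX; apply: measurable_sum => a;
  apply: measurable_funM => //; apply: measurableT_comp => //;
  apply: continuous_measurable_fun; [exact: continuous_cos|exact:
    continuous_sin].
Qed.

End intensity_theory.

(** * The measure dV and its support *)

Lemma mnormalizeE d (T : measurableType d) (R : realType)
    (m : {measure set T -> \bar R}) (P : probability T R) X :
  m setT != 0%E -> m setT != +oo%E ->
  mnormalize m P X = (m X * (fine (m setT))^-1%:E)%E.
Proof. by move=> m0 moo; rewrite /mnormalize (negbTE m0) (negbTE moo). Qed.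

(** Integrating the pointwise estimate keeps the bound [e], because [P] has total mass 1, while the
    sum integrates to #|J| times the common mean [I]. *)
Lemma probability_integral_average d (T : measurableType d) (R : realType)
    (P : probability T R) (J : finType) (f : J -> T -> R) (I m e : R) :
  (forall j, P.-integrable setT (EFin \o f j)) ->
  (forall j, (\int[P]_t (f j t)%:E)%E = I%:E) ->
  (forall t, `|\sum_j f j t - m| <= e) -> `|#|J|%:R * I - m| <= e.
Proof.
move=> fi fI fm.
have ic (r : R) : (\int[P]_t (cst r%:E t) = r%:E)%E.
  rewrite (integral_cst P)// [X in (_ * X)%E](_ : _ = 1%E) ?mule1//.
  exact: probability_setT.
have mi : P.-integrable setT (EFin \o cst m)
  by exact: finite_measure_integrable_cst.
have si : P.-integrable setT (EFin \o (fun t => \sum_j f j t)).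
  rewrite (_ : _ \o _ = (fun t => \sum_j (f j t)%:E)%E).
    by apply: (@integrable_sum _ _ _ P _ _ _ _ _ (fun j => EFin \o f j)).
  by apply/funext => t /=; rewrite sumEFin.
have sI : (\int[P]_t (\sum_j f j t - m)%:E)%E = (#|J|%:R * I - m)%:E.
  under eq_integral do rewrite EFinB.
  rewrite integralB_EFin// ic.
  under eq_integral do rewrite -sumEFin.
  rewrite (@integral_sum _ _ _ P _ _ _ (fun j t => (f j t)%:E))//.
  under eq_bigr do rewrite fI.
  by rewrite sumEFin sumr_const -[I *+ _]mulr_natl.
have mf : measurable_fun setT (fun t => (\sum_j f j t - m)%:E).
  apply/measurable_EFinP/measurable_funB => //.
  by have /measurable_int/measurable_EFinP := si.
rewrite -lee_fin (_ : _%:E = `|(#|J|%:R * I - m)%:E|%E)// -sI.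
apply: le_trans (le_abse_integral _ _ mf) _ => //.
rewrite -[leRHS]ic.
apply: ge0_le_integral => //=.
- apply/measurable_EFinP; apply: measurableT_comp => //.
  exact/measurable_EFinP.
- by move=> t _; rewrite lee_fin (le_trans _ (fm t)).
Qed.

Section diffraction_measure.
Context {R : realType} {n : nat} (A : {fset 'rV[int]_n})
  (c : 'rV[int]_n -> nat).
Variable E : 'M[R]_n.
Hypothesis uE : E \in unitmx.
Hypothesis LE : forall x, period_lattice A x <-> x *m E \is a mxOver Num.int.
Local Notation RR := (measurableTypeR R).
Local Notation row := (@row_of_tuple R n).
Local Notation L := (@period_lattice R n A).
Local Notation F := (fundamental_domain L).
Local Notation phi := (@intensity R n A c).
Let phiP : lattice_periodic L phi := intensity_periodic c.

(** The choice made by [xget] is proper because the parallelepiped is a candidate. *)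
Lemma fundamental_domainP : is_fundamental_domain L F.
Proof.
apply: (@xgetPex _ set0 [set X | is_fundamental_domain L X]).
by exists (parallelepiped E); exact: parallelepiped_fundamental.
Qed.
Let dF := fundamental_domainP.
Let mF : measurable (row @^-1` F) := dF.1.

(** The Dirac mass at 0 fills the default that [mnormalize] requires for total mass 0 or
    infinity. *)
Definition normalized_measure : probability (n.-tuple RR) R :=
  mnormalize (mrestr (@lebesgue_tuple R n) mF)
    (\d_[tuple (0 : RR) | i < n] : probability (n.-tuple RR) R).
Local Notation nu := normalized_measure.

Lemma normalized_measureE X : nu (row @^-1` X) =
  (volume (F `&` X) * (fine (volume F))^-1%:E)%E.
Proof.
apply: etrans (mnormalizeE _ _ _ _) _; rewrite /= /mrestr ?setTI.
- exact/negbT/gt_eqF/(volume_fundamental_gt0 uE LE dF).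
- exact/negbT/lt_eqF/(volume_fundamental_lty uE LE dF).
- by rewrite -preimage_setI setIC.
Qed.

Let L0 : L 0.
Proof.
by apply/LE; rewrite mul0mx; apply/mxOverP => i j; rewrite mxE rpred0.
Qed.

(** A periodic set is a union of classes, so it is recovered from its image in the quotient. *)
Lemma preimage_classes (X : set 'rV[R]_n) : lattice_periodic L X ->
  coset_mod L @^-1` classes A X = X.
Proof.
move=> XP; apply/seteqP; split=> [t [s Xs st]|t Xt]; last by exists t.
have : coset_mod L s t by rewrite st /coset_mod/= subrr.
by rewrite /coset_mod/= => /(XP s); rewrite addrC subrK => ->.
Qed.

Lemma normalized_volumeE (X : set 'rV[R]_n) : lattice_periodic L X ->
  normalized_volume L (classes A X) = nu (row @^-1` X).
Proof.
move=> XP; rewrite normalized_measureE /normalized_volume /quotient_volume.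
by rewrite preimage_classes// preimage_range setIT.
Qed.

(** Preimages under the intensity are periodic, whatever the set [X]. The equality of set functions
    lets an integral against [dV] be rewritten as one against a bundled measure. *)
Lemma dVE : dV A c = pushforward nu (phi \o row).
Proof.
apply/funext => X; rewrite /dV normalized_volumeE// => x l Ll.
by rewrite /preimage/= phiP.
Qed.

Lemma VE r : V A c r = fine (nu [set t | phi (row t) <= r]).
Proof.
by rewrite /V normalized_volumeE// => x l Ll /=; rewrite phiP.
Qed.

Lemma normalized_measure_gt0 (X : set 'rV[R]_n) x0 e : rmeasurable X ->
  lattice_periodic L X -> 0 < e -> cube x0 e `<=` X -> (0 < nu (row @^-1` X))%E.
Proof.
move=> mX XP e0 eX; rewrite normalized_measureE mule_gt0//.
  exact: (volume_periodic_gt0 uE LE dF mX XP e0 eX).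
rewrite lte_fin invr_gt0 fine_gt0// (volume_fundamental_gt0 uE LE)//.
by rewrite (volume_fundamental_lty uE LE).
Qed.

Let mphi : measurable_fun setT (fun t => phi (row t)) :=
  measurable_intensity A c.

Lemma rmeasurable_intensity (Y : set R) :
  measurable Y -> rmeasurable (phi @^-1` Y).
Proof.
by move=> mY; rewrite /rmeasurable -[X in measurable X]setTI; exact: mphi.
Qed.

Lemma intensity_cube (x0 : 'rV[R]_n) (e : R) : 0 < e ->
  exists2 d : R, 0 < d & forall x, cube x0 d x -> `|phi x - phi x0| < e.
Proof.
move=> e0; have [K K0 phiK] := @intensity_lipschitz R n A c.
exists (e / K / 2); first by rewrite !divr_gt0.
move=> x xd; apply: le_lt_trans (phiK _ _ (e / K / 2) _ _) _.
- by rewrite ltW// !divr_gt0.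
- by move=> i; exact/ltW/xd.
- by rewrite mulrA mulrCA divff ?gt_eqF// mulr1 ltr_pdivrMr// ltr_pMr// ltr1n.
Qed.

(** By continuity the intensity stays below [r] on a cube around [t] and above [r] on a cube around
    [s], so both periodic sets have positive measure. *)
Lemma V_between t s r : phi t < r -> r < phi s -> 0 < V A c r < 1.
Proof.
move=> tr rs; rewrite VE.
have mle : rmeasurable [set x | phi x <= r].
  rewrite (_ : [set _ | _] = phi @^-1` `]-oo, r]%classic); last first.
    by apply/seteqP; split=> x /=; rewrite in_itv.
  exact: rmeasurable_intensity.
have mgt : rmeasurable [set x | phi x > r].
  rewrite (_ : [set _ | _] = phi @^-1` `]r, +oo[%classic); last first.
    by apply/seteqP; split=> x /=; rewrite in_itv/= andbT.
  exact: rmeasurable_intensity.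
have nle : (0 < nu [set t | (phi (row t) <= r)%R])%E.
  have [|d d0 dP] := @intensity_cube t (r - phi t); first by rewrite subr_gt0.
  apply: (normalized_measure_gt0 mle _ d0) => [x l Ll|x /dP];
    first by rewrite /= phiP.
  by rewrite ltr_norml => /andP[_]; rewrite ltrD2r => /ltW.
have ngt : (0 < nu [set t | (r < phi (row t))%R])%E.
  have [|d d0 dP] := @intensity_cube s (phi s - r); first by rewrite subr_gt0.
  apply: (normalized_measure_gt0 mgt _ d0) => [x l Ll|x /dP];
    first by rewrite /= phiP.
  by rewrite ltr_norml => /andP[+ _]; rewrite opprB ltrD2r.
have fle := fin_num_measure nu _ mle; have fgt := fin_num_measure nu _ mgt.
rewrite fine_gt0 ?nle ?ltey_eq ?fle//.
have -> : [set t | phi (row t) <= r] = ~` [set t | r < phi (row t)].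
  apply/seteqP; split=> x /=; last by move=> /negP; rewrite -leNgt.
  by move=> xr; apply/negP; rewrite -leNgt.
rewrite (probability_setC nu)// fineB// ltrBlDr ltrDl.
by rewrite fine_gt0 ?ngt ?ltey_eq ?fgt.
Qed.

(** As another value [phi s] exists, there are numbers strictly between it and [phi t] arbitrarily
    close to [phi t], and [V_between] applies to them. *)
Lemma spectrum_intensity : (exists t s, phi t != phi s) ->
  forall t, spectrum A c (phi t).
Proof.
move=> [t1 [t2 t12]] t.
have [s ts] : exists s, phi t != phi s.
  have [tt1|] := eqVneq (phi t) (phi t1); last by exists t1.
  by exists t2; rewrite tt1.
move=> X /nbhs_ballP[e /= e0 eX].
have e2 : 0 < e by [].
have ball_mid (r : R) : `|phi t - r| < e -> X r by move=> tr; exact: eX.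
move: ts; rewrite neq_lt => /orP[ts|st].
  (* The midpoint between [phi t] and the smaller of [phi s] and [phi t + e] is within [e] of
     [phi t] and strictly below [phi s]. *)
  pose r := (phi t + Num.min (phi s) (phi t + e)) / 2; exists r.
  have tm : phi t < Num.min (phi s) (phi t + e) by rewrite lt_min ts ltrDl.
  have ms : Num.min (phi s) (phi t + e) <= phi s by rewrite ge_min lexx.
  have me : Num.min (phi s) (phi t + e) <= phi t + e by rewrite ge_min lexx
    orbT.
  split; first by apply: (@V_between t s); rewrite /r; lra.
  by apply: ball_mid; rewrite ltr_norml /r; lra.
pose r := (phi t + Num.max (phi s) (phi t - e)) / 2; exists r.
have tm : Num.max (phi s) (phi t - e) < phi t by rewrite gt_max st gtrBl.
have ms : phi s <= Num.max (phi s) (phi t - e) by rewrite le_max lexx.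
have me : phi t - e <= Num.max (phi s) (phi t - e) by rewrite le_max lexx orbT.
split; first by apply: (@V_between s t); rewrite /r; lra.
by apply: ball_mid; rewrite ltr_norml /r; lra.
Qed.

(** A nonreal [z] is at distance at least |Im z| from the real line; a real [z] has a ball around it
    that misses the closed spectrum. *)
Lemma spectrum_distance z : (exists t s, phi t != phi s) ->
  (forall r : R, spectrum A c r -> z <> r%:C) ->
  exists2 d, 0 < d & forall t, d <= cabs (z - (phi t)%:C).
Proof.
move=> nc; case: z => a b zr.
have [b0|b0] := eqVneq b 0; last first.
  exists `|b|; first by rewrite normr_gt0.
  by move=> t; apply: le_trans (Im_le_cabs _); rewrite /= oppr0 addr0.
have na : (~` spectrum A c) a by move=> /zr; apply; rewrite b0.
have : nbhs a (~` spectrum A c).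
  by apply: open_nbhs_nbhs; split=> //; apply: closed_openC;
    exact: closed_closure.
move=> /nbhs_ballP[e e0 eP]; exists e; [exact: e0|move=> t].
apply: le_trans (Re_le_cabs _); rewrite /= leNgt; apply/negP => /eP; apply.
exact: spectrum_intensity.
Qed.

(** Translating the set by [u] replaces [F] by its translate, which is again a fundamental domain
    and hence gives the same volume. *)
Lemma normalized_measure_shift u (Y : set R) : measurable Y ->
  nu [set t | Y (phi (row t + u))] = nu [set t | Y (phi (row t))].
Proof.
move=> mY; rewrite (normalized_measureE [set x | Y (phi (x + u))]).
rewrite (normalized_measureE [set x | Y (phi x)]); congr mule.
have mYu : rmeasurable (F `&` [set x | Y (phi (x + u))]).
  by apply: measurableI => //; exact: (rmeasurable_shift u
    (rmeasurable_intensity mY)).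
rewrite -(volume_shift (- u) mYu).
rewrite (_ : [set x | _] = [set x | F (x - u)] `&` [set x | Y (phi x)]);
  last first.
  by apply/seteqP; split=> x /=; rewrite subrK.
apply: (volume_fundamental_domain (lattice_point_inj uE) (lattice_pointP uE LE)
  (lattice_subr LE)) => //.
- exact: fundamental_domain_shift.
- exact: rmeasurable_intensity.
- by move=> x l Ll /=; rewrite phiP.
Qed.

(** * Integrals against dV *)

Section integral.
Variable h : R -> R.
Hypothesis mh : measurable_fun setT h.
Variable M : R.
Hypothesis hM : forall t, `|h (phi t)| <= M.

Let hu_measurable u : measurable_fun setT (fun t => h (phi (row t + u))).
Proof.
apply: (measurableT_comp mh).
rewrite (_ : (fun _ => _) = (fun t => phi (row (tadd t (tuple_of_row u)))));
  last first.
  by apply/funext => t; rewrite row_tadd tuple_of_rowK.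
exact: (measurableT_comp mphi (measurable_tadd _)).
Qed.

Let hu_integrable u :
  nu.-integrable setT (EFin \o (fun t => h (phi (row t + u)))).
Proof.
apply: measurable_bounded_integrable => //; first by rewrite ltey_eq
  (fin_num_measure nu).
exists M; split; first exact: num_real.
by move=> x Mx t _; apply: le_trans (hM _) (ltW _).
Qed.

(** By translation invariance, [dV] agrees on measurable sets with the image of [nu] under the
    shifted intensity. *)
Lemma integral_dV_shift u :
  (\int[dV A c]_r (h r)%:E = \int[nu]_t (h (phi (row t + u)))%:E)%E.
Proof.
rewrite dVE.
pose fu t := phi (row t + u).
have mfu : measurable_fun setT fu.
  rewrite /fu (_ : (fun _ => _) = (fun t => phi (row (tadd t (tuple_of_row
    u))))); last first.
    by apply/funext => t; rewrite row_tadd tuple_of_rowK.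
  exact: (measurableT_comp mphi (measurable_tadd _)).
rewrite (@eq_measure_integral _ _ R setT (pushforward nu fu) (pushforward nu
  (phi \o row))); last first.
  by move=> Y mY _; apply/esym; exact: normalized_measure_shift.
rewrite (@integral_pushforward _ _ _ _ _ _ mfu nu setT (fun r => (h r)%:E))//.
- exact/measurable_EFinP.
- exact: hu_integrable.
Qed.

(** All translates have the same integral, so a nearly constant sum of translates determines this
    integral up to the error [e]. *)
Lemma integral_dV_average (J : finType) (u : J -> 'rV[R]_n) m e :
  (forall t, `|\sum_j h (phi (t + u j)) - m| <= e) ->
  `|#|J|%:R * fine (\int[dV A c]_r (h r)%:E)%E - m| <= e.
Proof.
move=> me; set I := (\int[_]_(_ in _) _)%E.
have If : I \is a fin_num.
  by rewrite /I (integral_dV_shift 0) integrable_fin_num//;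
    exact: hu_integrable.
apply: (@probability_integral_average _ _ _ nu J (fun j t => h (phi (row t + u
  j)))).
- by move=> j; exact: hu_integrable.
- by move=> j; rewrite -integral_dV_shift fineK.
- by move=> t; exact: me.
Qed.

End integral.
End diffraction_measure.

(** * The grid (1/N) L / L *)

Lemma int_mod_ord N (m : int) : exists k : 'I_N.+1, exists q : int,
  m = q * N.+1%:Z + k%:Z.
Proof.
have d0 : (N.+1 : int) != 0 by [].
have := modz_ge0 m d0; have := ltz_pmod m (d := N.+1) isT.
case mk : (m %% N.+1)%Z => [k|//] kN _.
by exists (Ordinal kN), (m %/ N.+1)%Z; rewrite {1}(divz_eq m N.+1) mk.
Qed.

Section grid.
Context {R : realType} {n : nat} (E : 'M[R]_n) (L : set 'rV[R]_n).
Hypothesis uE : E \in unitmx.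
Hypothesis LE : forall x, L x <-> x *m E \is a mxOver Num.int.
Variable N : nat.
Local Notation J := {ffun 'I_n -> 'I_N.+1}.

(** Representatives of (1/(N+1)) L modulo L. The successor keeps the denominator nonzero and makes
    the index type the group (Z/(N+1))^n. *)
Definition grid_point (k : J) : 'rV[R]_n :=
  N.+1%:R^-1 *: ((\row_i (k i : nat)%:R) *m invmx E).

Lemma grid_pointE k i : (grid_point k *m E) 0 i = N.+1%:R^-1 * (k i : nat)%:R.
Proof. by rewrite /grid_point -scalemxAl mulmxKV// !mxE. Qed.

Lemma latticeP x : (forall i, (x *m E) 0 i \is a Num.int) -> L x.
Proof. by move=> xi; apply/LE/mxOverP => i j; rewrite ord1. Qed.

Lemma lattice_addr x y : L x -> L y -> L (x + y).
Proof.
move=> /LE/mxOverP xL /LE/mxOverP yL; apply: latticeP => i.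
by rewrite mulmxDl mxE rpredD.
Qed.

(** The coordinates of [u] are reduced modulo N+1. *)
Lemma grid_point_rep u : L u -> exists k, L (N.+1%:R^-1 *: u - grid_point k).
Proof.
move=> /LE/mxOverP uL.
have /fin_all_exists[k kP] : forall i, exists k : 'I_N.+1, exists q : int,
    (u *m E) 0 i = (q * N.+1%:Z + k%:Z)%:~R.
  move=> i; have /intrP[m ->] := uL 0 i.
  by have [k [q ->]] := int_mod_ord N m; exists k, q.
exists [ffun i => k i]; apply: latticeP => i.
rewrite mulmxBl mxE [X in _ + X]mxE grid_pointE ffunE -scalemxAl mxE.
have [q ->] := kP i.
by rewrite intrD intrM mulrDr addrK mulrCA mulVf ?mulr1 ?rpred_int// pnatr_eq0.
Qed.

(** Ordinals add modulo N+1, and each carry changes a coordinate by an integer. *)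
Lemma grid_pointD k k' : L (grid_point k + grid_point k' - grid_point (k + k')).
Proof.
apply: latticeP => i.
rewrite mulmxBl mulmxDl mxE [X in X + _]mxE [X in _ + X]mxE !grid_pointE
  ffunE/=.
rewrite -mulrDr -mulrBr -natrD [X in X%:R - _](divn_eq _ N.+1) natrD addrK
  natrM.
by rewrite mulrCA mulVf ?mulr1 ?rpred_nat// pnatr_eq0.
Qed.

(** The difference of two indices is a multiple of N+1 and smaller than N+1 in absolute value. *)
Lemma grid_point_inj k k' : L (grid_point k - grid_point k') -> k = k'.
Proof.
move=> /LE/mxOverP kL; apply/ffunP => i; apply/val_inj => /=.
have N0 : (0 : R) < N.+1%:R by rewrite ltr0n.
have := kL 0 i; rewrite mulmxBl mxE [X in _ + X]mxE !grid_pointE -mulrBr =>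
  /intrP[m mE].
have mk : (k i : nat)%:R - (k' i : nat)%:R = m%:~R * N.+1%:R :> R.
  by rewrite -mE mulrAC mulVf ?mul1r// gt_eqF.
have m0 : m = 0.
  have : `|m%:~R * N.+1%:R : R| < N.+1%:R.
    rewrite -mk ltr_norml; have := ltn_ord (k i); have := ltn_ord (k' i).
    rewrite -!(ltr_nat R); have := ler0n R (k i); have := ler0n R (k' i); lra.
  rewrite normrM [X in _ * X]ger0_norm ?ltW// gtr_pMl// -intr_norm.
  by rewrite -[1]/(1%:~R) ltr_int; case: {mE mk} m => [[|?]|?].
by apply/eqP; rewrite -(eqr_nat R) -subr_eq0 mk m0 mul0r.
Qed.

Lemma card_grid : #|{: J}| = (N.+1 ^ n)%N.
Proof. by rewrite card_ffun !card_ord. Qed.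

(* The sum is invariant under (1/N) L, which moves t into (1/N) times the
   parallelepiped. *)
Lemma grid_sum_dist (g : 'rV[R]_n -> R) (K Kp : R) : 0 <= Kp ->
  lattice_periodic L g ->
  (forall (t s : 'rV[R]_n) (e : R), 0 <= e ->
     (forall i, `|t 0 i - s 0 i| <= e) -> `|g t - g s| <= K * e) ->
  (forall x, parallelepiped E x -> forall j, `|x 0 j| <= Kp) ->
  forall t, `|\sum_k g (t + grid_point k) - \sum_k g (grid_point k)| <=
    (N.+1 ^ n)%:R * (K * (Kp / N.+1%:R)).
Proof.
move=> Kp0 gP gK PK t.
have N0 : (0 : R) < N.+1%:R by rewrite ltr0n.
have [l Ll Pl] := fundamental_domain_rep (N.+1%:R *: t)
  (parallelepiped_fundamental uE LE).
have LNl : L (- l).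
  apply: latticeP => i; rewrite mulNmx mxE rpredN.
  by have /LE/mxOverP := Ll; apply.
have [k0 k0P] := grid_point_rep LNl.
pose w := N.+1%:R^-1 *: (N.+1%:R *: t + l).
pose l' := N.+1%:R^-1 *: - l - grid_point k0.
(* A small vector, a grid point and a lattice vector; periodicity removes the last. *)
have tE : t = w + grid_point k0 + l'.
  rewrite /w /l' scalerDr scalerA mulVf ?gt_eqF// scale1r scalerN.
  by rewrite -addrA [grid_point _ + _]addrCA subrr addr0 addrK.
have -> : \sum_k g (t + grid_point k) = \sum_k g (w + grid_point k).
  (* Adding [k0] permutes the indices and so absorbs the grid point. *)
  rewrite [RHS](reindex_inj (addrI k0)); apply: eq_bigr => k _.
  rewrite tE addrAC gP// -[RHS](gP _ _ (grid_pointD k0 k)); congr g.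
  by rewrite -[RHS]addrA [X in _ = _ + X]addrC subrK addrA.
rewrite -sumrB; apply: le_trans (ler_norm_sum _ _ _) _.
rewrite -card_grid mulr_natl -sumr_const; apply: ler_sum => k _.
apply: gK => [|i]; first by rewrite divr_ge0.
rewrite !mxE addrK normrM ger0_norm ?invr_ge0// mulrC ler_wpM2r ?invr_ge0//.
by have := PK _ Pl i; rewrite !mxE.
Qed.

End grid.

(** * Multiplicities and B_N in terms of the grid *)

Section mult_grid.
Context {R : realType} {n : nat} (A : {fset 'rV[int]_n})
  (c : 'rV[int]_n -> nat).
Variable E : 'M[R]_n.
Hypothesis uE : E \in unitmx.
Hypothesis LE : forall x, period_lattice A x <-> x *m E \is a mxOver Num.int.
Variable N : nat.
Local Notation L := (@period_lattice R n A).
Local Notation phi := (@intensity R n A c).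
Local Notation J := {ffun 'I_n -> 'I_N.+1}.
Local Notation pt := (@grid_point R n E N).
Let phiP : lattice_periodic L phi := intensity_periodic c.

(** The classes of the grid points are distinct and exhaust (1/(N+1)) L modulo L, so indices may be
    counted in their place. *)
Lemma mult_grid (r : R) : mult A c N.+1 r = #|[pred k : J | phi (pt k) == r]|.
Proof.
rewrite /mult; pose q k := coset_mod L (pt k).
have q_inj : injective q.
  move=> k k' qk; apply: (grid_point_inj uE LE); rewrite -[L _]/(q k' (pt k))
    -qk.
  by rewrite /q /coset_mod/= subrr; apply/LE; rewrite mul0mx; apply/mxOverP =>
    i j; rewrite mxE rpred0.
pose s := [seq q k | k <- enum [pred k : J | phi (pt k) == r]].
(* [fset_set] is empty on infinite sets, so the classes are first exhibited as a finite list. *)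
rewrite (_ : classes _ _ = [set` [fset x in s]%fset]); last first.
  apply/seteqP; split=> [_ [t [[u Lu <-] phit] <-]|X /=].
    have [k kP] := grid_point_rep uE LE N Lu.
    rewrite /= !inE; apply/mapP; exists k.
      rewrite mem_enum inE/= -phit -(phiP (pt k) kP) addrC subrK//.
    apply/seteqP; split=> x; rewrite /q /coset_mod/= => xL.
      by rewrite -(subrKA (N.+1%:R^-1 *: u)); exact: (lattice_addr LE).
    by rewrite -(subrKA (pt k)) -(opprB _ (pt k)); exact: (lattice_subr LE).
  rewrite !inE => /mapP[k]; rewrite mem_enum inE => /eqP kr ->.
  exists (pt k) => //; split=> //.
  exists (N.+1%:R *: pt k); last by rewrite scalerA mulVf ?scale1r// pnatr_eq0.
  apply: (latticeP LE) => i; rewrite -scalemxAl mxE grid_pointE//.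
  by rewrite mulVKf ?pnatr_eq0// rpred_nat.
by rewrite set_fsetK card_fseq undup_id ?map_inj_uniq ?enum_uniq// size_map
  -cardE.
Qed.

(** Grouping the grid points by their intensity turns the multiplicities into repeated factors. *)
Lemma B_grid z : B A c N.+1 z = \prod_(k : J) (z - (phi (pt k))%:C).
Proof.
pose s := undup [seq phi (pt k) | k : J].
have sP k : phi (pt k) \in s by rewrite mem_undup; apply/mapP; exists k;
  rewrite ?mem_enum.
(* Values outside [s] have multiplicity 0 and contribute the factor 1. *)
rewrite /B (fsbigE s) ?undup_uniq//; last first.
  move=> r _ rs; rewrite mult_grid eq_card0 ?expr0// => k; rewrite !inE.
  by apply: contraNF rs => /eqP <-.
under eq_bigl do rewrite in_setT.
transitivity (\prod_(r <- s) \prod_(k : J | phi (pt k) == r) (z - (phi (pt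
  k))%:C)).
  apply: eq_bigr => r _; rewrite mult_grid -prodr_const; apply: eq_bigr => k.
  by rewrite inE => /eqP ->.
(* As [s] has no repetitions, each [k] occurs for exactly one [r]. *)
rewrite (exchange_big_dep xpredT)//=; apply: eq_bigr => k _.
rewrite -big_filter (eq_filter (a2 := pred1 (phi (pt k)))); last first.
  by move=> r; rewrite /= eq_sym.
by rewrite filter_pred1_uniq ?undup_uniq// big_seq1.
Qed.

End mult_grid.

(** * The limit *)

(** For d <= u <= v, ln v - ln u = ln (1 + (v - u) / u) is at most (v - u) / u, hence at most (v -
    u) / d. *)
Lemma ln_lipschitz (R : realType) (d x y : R) : 0 < d -> d <= x -> d <= y ->
  `|ln x - ln y| <= d^-1 * `|x - y|.
Proof.
move=> d0.
suff le u v : d <= u -> u <= v -> `|ln v - ln u| <= d^-1 * `|v - u|.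
  move=> dx dy; have [xy|/ltW yx] := leP x y; last exact: le.
  by rewrite distrC (distrC x); exact: le.
move=> du uv; have u0 := lt_le_trans d0 du; have v0 := lt_le_trans u0 uv.
rewrite -ln_div ?posrE// ger0_norm; last by rewrite ln_ge0// ler_pdivlMr//
  mul1r.
rewrite ger0_norm ?subr_ge0//.
have vu : v / u = 1 + (v - u) / u by field; rewrite gt_eqF.
rewrite vu; apply: le_trans (le_ln1Dx _) _.
  by rewrite (lt_le_trans (ltrN10 R))// divr_ge0 ?subr_ge0// ltW.
by rewrite mulrC ler_wpM2r ?subr_ge0// lef_pV2 ?posrE.
Qed.

Lemma ln_prod (R : realType) (I : finType) (f : I -> R) : (forall k, 0 < f k) ->
  ln (\prod_k f k) = \sum_k ln (f k).
Proof.
move=> f0; rewrite -[RHS]expRK expR_sum; congr ln.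
by apply: eq_bigr => k _; rewrite lnK// posrE.
Qed.

Lemma measurable_ln_cabs (R : realType) (z : R[i]) :
  measurable_fun setT (fun r : R => ln (cabs (z - r%:C))).
Proof.
apply: measurableT_comp => //; case: z => a b.
rewrite (_ : (fun _ => _) = (fun r : R => Num.sqrt ((a - r) ^+ 2 + b ^+ 2)));
  last first.
  by apply/funext => r; rewrite /cabs/= oppr0 addr0.
apply: measurableT_comp.
  by apply: continuous_measurable_fun; exact: sqrt_continuous.
by apply: measurable_funD => //; apply: measurable_funX; exact: measurable_funB.
Qed.

Theorem proposition1 (R : realType) (n : nat) (A : {fset 'rV[int]_n})
    (c : 'rV[int]_n -> nat) (z : R[i]) :
  (0 < n)%N ->
  (forall a, a \in A -> (0 < c a)%N) ->
  has_rank (difference_lattice A) n ->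
  (forall r : R, spectrum A c r -> z <> r%:C) ->
  cabs (B A c N z) `^ (- (N%:R ^- n)) @[N --> \oo] --> Q A c z.
Proof.
move=> n0 c0 rk zS.
have [E uE LE] := @period_lattice_basis R n A rk.
have [d d0 dz] := spectrum_distance uE LE (intensity_nonconstant n0 c0 rk) zS.
pose h (r : R) := ln (cabs (z - r%:C)).
pose phi := @intensity R n A c.
pose I := fine (\int[dV A c]_r (h r)%:E)%E.
have [K K0 phiK] := @intensity_lipschitz R n A c.
have hP : lattice_periodic (@period_lattice R n A) (h \o phi).
  by move=> x l Ll; rewrite /= /phi intensity_periodic.
(* The logarithm contributes [d^-1], since both moduli are at least [d], and the intensity
   contributes [K]. *)
have hK (t s : 'rV[R]_n) (e : R) : 0 <= e ->
    (forall i, `|t 0 i - s 0 i| <= e) ->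
    `|(h \o phi) t - (h \o phi) s| <= d^-1 * K * e.
  move=> e0 ts; apply: le_trans (ln_lipschitz d0 (dz t) (dz s)) _.
  rewrite -mulrA ler_wpM2l ?invr_ge0 ?(ltW d0)//.
  apply: le_trans (cabs_dist _ _) (le_trans _ (phiK _ _ _ e0 ts)).
  by rewrite opprD opprK addrACA subrr add0r addrC -rmorphB cabs_real distrC.
have [Kp Kp0 PK] := parallelepiped_bounded uE.
have [M hM] : exists M, forall t, `|h (phi t)| <= M.
  (* The intensity is at most the square of the sum of the c_a, so [h] takes its values between
     [ln d] and [ln U], whose signs are unknown. *)
  pose U := cabs z + (\sum_(a <- A) (c a)%:R) ^+ 2.
  exists (`|ln d| + `|ln U|) => t.
  have xU : cabs (z - (phi t)%:C) <= U.
    apply: le_trans (cabsD _ _) _; rewrite cabsN cabs_real lerD2l.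
    by rewrite ger0_norm ?sqr_ge0// lerXn2r ?nnegrE ?cabs_ge0 ?sumr_ge0//
      cabs_Dhat_le.
  have x0 := lt_le_trans d0 (dz t); have U0 := lt_le_trans x0 xU.
  have lx : ln d <= h (phi t) by rewrite ler_ln ?posrE ?dz.
  have xl : h (phi t) <= ln U by rewrite ler_ln ?posrE.
  rewrite ler_norml; have := ler_norm (ln U); have := ler_norm (- ln d).
  rewrite normrN; have := normr_ge0 (ln U); have := normr_ge0 (ln d); lra.
(* By [B_grid] this is (N+1)^-n times the logarithm of |B_{N+1}(z)|. *)
pose a N := (N.+1 ^ n)%:R^-1 *
  \sum_(k : {ffun 'I_n -> 'I_N.+1}) h (phi (grid_point E k)) : R.
have aI N : `|I - a N| <= d^-1 * K * Kp * N.+1%:R^-1.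
  have Nn0 : (0 : R) < (N.+1 ^ n)%:R by rewrite ltr0n expn_gt0.
  have := integral_dV_average uE LE (measurable_ln_cabs z) hM
    (grid_sum_dist uE LE N (ltW Kp0) hP hK PK).
  rewrite card_grid -/I => IN.
  rewrite -(ler_pM2l Nn0) -{1}(gtr0_norm Nn0) -normrM mulrBr mulVKf ?gt_eqF//.
  by apply: le_trans IN _; rewrite !mulrA.
have a_cvg : a @ \oo --> I.
  apply/cvgrPdist_le => e e0.
  have : (fun N => d^-1 * K * Kp * harmonic N) @ \oo --> d^-1 * K * Kp * 0.
    by apply: cvgMr; exact: cvg_harmonic.
  rewrite mulr0 => /cvgrPdist_le /(_ e e0); apply: filterS => N.
  rewrite sub0r normrN; apply: le_trans; apply: le_trans (aI N) _.
  exact: ler_norm.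
have ea : (fun N => expR (- a N)) @ \oo --> expR (- I).
  by apply: (cvg_comp _ _ (cvgN a_cvg)); exact: continuous_expR.
(* The grids have denominator [N.+1], so the sequence is shifted by one, which leaves its limit
   unchanged. *)
rewrite -cvg_shiftS (_ : [sequence _]_N = (fun N => expR (- a N)));
  first exact: ea.
apply/funext => N; have Bgt0 (k : {ffun 'I_n -> 'I_N.+1}) :
    0 < cabs (z - (phi (grid_point E k))%:C).
  exact: lt_le_trans (dz _).
transitivity (cabs (B A c N.+1 z) `^ (- (N.+1%:R ^- n))); first by [].
rewrite (B_grid c uE LE) (big_morph _ (@cabsM R) (@cabs1 R)).
(* On a positive base [powR] is the exponential of the exponent times the logarithm; base 0 is a
   separate case of its definition. *)
rewrite /powR gt_eqF ?prodr_gt0// ln_prod//.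
by rewrite mulNr -natrX.
Qed.
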